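(* Consider the incremental cycle detection problem on $n$ vertices with $m$ arc insertions, processed by algorithm Insert described below with a random $q$-labeling with $q=\sqrt[3]{\log n/n}$, where each vertex $v$ additionally maintains the list of its immediate predecessors (in-neighbors) whose label equals $\ell(v)$ (maintained by $v$ storing, whenever its label changes, the in-neighbors that sent it an Update with this new label), and the backward search uses only these lists. Then the expected total running time of the algorithm is $O(m\,n^{2/3}(\log n)^{4/3})$.
   Context: Problem: arcs are inserted one by one into an initially arc-less directed graph on $V$, $|V|=n$; the algorithm must report when an inserted arc closes a directed cycle, after which it halts. A $q$-labeling: each vertex is independently ranked with probability $q$; the ranked set $L$ receives a uniformly random injective ranking; unranked vertices have rank $\infty$. Labels (of the current DAG): $P(v)$ = vertices with a path to $v$, $S(v)$ = vertices reachable from $v$ ($v\in P(v)\cap S(v)$), $D(x,y)=S(x)\cap P(y)$; $A_1(v)=P(v)\cap L$; for $i\ge1$, if $A_i(v)\ne\emptyset$, $\ell_i(v)$ = minimum-rank vertex of $A_i(v)$ and $A_{i+1}(v)=(D(\ell_i(v),v)\setminus\{\ell_i(v)\})\cap L$; $k(v)$ = $0$ if $A_1(v)=\emptyset$, else largest $i$ with $A_i(v)\ne\emptyset$; $\ell(v)=(\ell_1(v),\ldots,\ell_{k(v)}(v))$; $\rho(v)=(r(\ell_1(v)),\ldots,r(\ell_{k(v)}(v)),+\infty)$, compared lexicographically ($+\infty$ above all integers). $\mathrm{LCP}(x,y)$ = longest common prefix of $\ell(x),\ell(y)$. Insert$(u,v)$: (1) if $\rho(u)>_{\mathrm{lex}}\rho(v)$,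 return; (2) Cycle-Detect$(u,v)$; (3) if no cycle and $\rho(u)<_{\mathrm{lex}}\rho(v)$, call Update$(u,v)$. Cycle-Detect$(u,v)$: Backward search from $u$ over in-arcs, continuing from a vertex $w\ne v$ only if $\ell(w)=\ell(u)$ (each vertex expanded once), stopping at vertices with $\rho(w)>_{\mathrm{lex}}\rho(u)$ or without in-neighbors, and reporting a cycle if $v$ is reached. Forward search (if $\rho(u)<_{\mathrm{lex}}\rho(v)$) from $v$ over out-arcs: a vertex reached by the backward search reports a cycle; a vertex $w$ with $\rho(u)<_{\mathrm{lex}}\rho(w)$ is expanded (once); a vertex with $\rho(u)\ge_{\mathrm{lex}}\rho(w)$ or without out-neighbors is not expanded. Results are reported back along the search arcs. Update$(x,y)$: write $\ell(x)=\mathrm{LCP}(x,y)\|\zeta$; let $\zeta'$ be the longest prefix of $\zeta$ whose vertices all have rank $<r(y)$; set $\ell(y)=\mathrm{LCP}(x,y)\|\zeta'\|y$ if $y$ ranked, else $\ell(y)=\mathrm{LCP}(x,y)\|\zeta'$; if $\ell(y)$ changed, call Update$(y,w)$ for all arcs $(y,w)$.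
   Formalization: Update(x,y) recomputes ℓ(y) only if ρ(x) <lex ρ(y), also in recursive calls; as written, without this guard, a recursive Update can replace a correct label by a wrong one, contradicting the definition of ℓ. *)

(* Defs.v *)
From HB Require Import structures.
From mathcomp Require Import all_boot all_order all_algebra.
From mathcomp Require Import all_classical all_reals all_analysis.

Set Implicit Arguments.
Unset Strict Implicit.
Unset Printing Implicit Defensive.

Local Open Scope nat_scope.

(* A labeling assigns a rank to some vertices; None is the rank +oo of an
   unranked vertex. *)
Definition labeling (n : nat) := {ffun 'I_n -> option 'I_n}.

Definition ranked (n : nat) (r : labeling n) : {set 'I_n} :=
  finset (fun v => isSome (r v)).

Definition rankings (n : nat) (L : {set 'I_n}) : {set labeling n} :=
  finset (fun r => (ranked r == L) && dinjectiveb r L).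

Definition labelings (n : nat) : {set labeling n} :=
  finset (fun r => r \in rankings (ranked r)).

(* Expectation over a random q-labeling: every vertex is in L independently
   with probability q, then the ranking is uniform in rankings L. *)
Definition qexpect (R : realType) (n : nat) (q : R) (X : labeling n -> R) : R :=
  (\sum_(L : {set 'I_n})
     (\prod_(v : 'I_n) (if v \in L then q else 1 - q)) *
     ((\sum_(r in rankings L) X r) / #|rankings L|%:R))%R.

(* Finite ranks are < n, so n stands for +oo. *)
Definition rank (n : nat) (r : labeling n) (v : 'I_n) : nat :=
  if r v is Some i then i else n.

(* The type seqlexi nat carries the lexicographic order. *)
Definition rho (n : nat) (r : labeling n) (l : seq 'I_n) : seqlexi nat :=
  rcons [seq rank r x | x <- l] n.

(* e is the arc relation of the current DAG. *)
Definition Pset (n : nat) (e : rel 'I_n) (v : 'I_n) : {set 'I_n} :=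
  finset (fun x => connect e x v).
Definition Sset (n : nat) (e : rel 'I_n) (v : 'I_n) : {set 'I_n} :=
  finset (fun x => connect e v x).
Definition Dset (n : nat) (e : rel 'I_n) (x y : 'I_n) : {set 'I_n} :=
  Sset e x :&: Pset e y.

(* With A = A_i(v), the sequence l_i(v), l_(i+1)(v), ...  In a DAG the sets
   A_i(v) strictly decrease, so k = n unfoldings are enough from A_1(v). *)
Fixpoint label_from (n : nat) (r : labeling n) (e : rel 'I_n) (v : 'I_n)
    (k : nat) (A : {set 'I_n}) : seq 'I_n :=
  if k is k'.+1 then
    if [pick x in A | [forall y in A, rank r x <= rank r y]] is Some x
    then x :: label_from r e v k' ((Dset e x v :\ x) :&: ranked r)
    else [::]
  else [::].

Definition label (n : nat) (r : labeling n) (e : rel 'I_n) (v : 'I_n) :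
    seq 'I_n :=
  label_from r e v n (Pset e v :&: ranked r).

Fixpoint lcp (T : eqType) (s t : seq T) : seq T :=
  match s, t with
  | x :: s', y :: t' => if x == y then x :: lcp s' t' else [::]
  | _, _ => [::]
  end.

(* Running time is counted in elementary steps (rank comparison, list entry
   read or written, arc traversed, vertex marked).  A computation returns its
   result with the number of steps; None means that the fuel ran out. *)
Definition comp (A : Type) := option (A * nat).
Definition ret (A : Type) (a : A) : comp A := Some (a, 0).
Definition charge (A : Type) (c : nat) (m : comp A) : comp A :=
  omap (fun p => (p.1, c + p.2)) m.
Definition bind (A B : Type) (m : comp A) (f : A -> comp B) : comp B :=
  if m is Some (a, c) then charge c (f a) else None.
Notation "'let!' x := m 'in' f" := (bind m (fun x => f))
  (at level 200, x name, m at level 200, f at level 200).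

(* The lexicographic comparison reads entries up to the first difference. *)
Definition cmp_cost (n : nat) (r : labeling n) (l l' : seq 'I_n) : nat :=
  (size (lcp (rho r l : seq nat) (rho r l' : seq nat))).+1.

(* lab v is the stored label of v; same v lists the in-neighbors of v whose
   label equals lab v. *)
Record state (n : nat) := State {
  out : 'I_n -> seq 'I_n;
  same : 'I_n -> seq 'I_n;
  lab : 'I_n -> seq 'I_n }.

Definition set_at (n : nat) (A : Type) (f : 'I_n -> A) (y : 'I_n) (a : A) :
    'I_n -> A :=
  fun w => if w == y then a else f w.

Definition init (n : nat) (r : labeling n) : state n :=
  State (fun=> [::]) (fun=> [::]) (label r (fun _ _ => false)).

Definition add_arc (n : nat) (u v : 'I_n) (s : state n) : state n :=
  State (set_at (out s) u (v :: out s u)) (same s) (lab s).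

Definition add_same (n : nat) (x y : 'I_n) (s : state n) : state n :=
  State (out s) (set_at (same s) y (x :: same s y)) (lab s).

(* Backward search towards v over the lists same; todo is the stack of reached
   vertices that remain to be handled, seen the set of reached vertices.  The
   factor 2 in the charge accounts for reporting back along the search arcs. *)
Fixpoint bsearch (n : nat) (s : state n) (v : 'I_n) (fuel : nat)
    (todo : seq 'I_n) (seen : {set 'I_n}) : comp (bool * {set 'I_n}) :=
  if todo is w :: todo' then
    if fuel is fuel'.+1 then
      if w == v then charge 1 (ret (true, seen)) else
      let new := [seq p <- same s w | p \notin seen] in
      charge (1 + 2 * size (same s w))
        (bsearch s v fuel' (new ++ todo') (seen :|: [set:: new]))
    else None
  else ret (false, seen).

(* Forward search; B is the set of vertices reached by the backward search
   from u. *)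
Fixpoint fsearch (n : nat) (r : labeling n) (s : state n) (u : 'I_n)
    (B : {set 'I_n}) (fuel : nat) (todo : seq 'I_n) (seen : {set 'I_n}) :
    comp bool :=
  if todo is w :: todo' then
    if fuel is fuel'.+1 then
      if w \in B then charge 1 (ret true) else
      charge (1 + cmp_cost r (lab s u) (lab s w))
        (if (rho r (lab s u) < rho r (lab s w))%O then
           let new := [seq x <- out s w | x \notin seen] in
           charge (2 * size (out s w))
             (fsearch r s u B fuel' (new ++ todo') (seen :|: [set:: new]))
         else fsearch r s u B fuel' todo' seen)
    else None
  else ret false.

(* The new label of y computed by Update(x, y). *)
Definition new_label (n : nat) (r : labeling n) (s : state n) (x y : 'I_n) :
    seq 'I_n :=
  let p := lcp (lab s x) (lab s y) in
  let zeta := drop (size p) (lab s x) in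
  let zeta' := take (find (fun z => rank r y <= rank r z) zeta) zeta in
  p ++ zeta' ++ (if y \in ranked r then [:: y] else [::]).

(* One call Update(x, y) without its recursive calls; the boolean tells whether
   the label of y changed.  As for the call issued by Insert, the label of y is
   recomputed only if rho(x) < rho(y): otherwise y has nothing to learn from x,
   and the formula could even increase rho(y), e.g. turn (a, b) into (a, c) if
   x has label (a, c), r(b) < r(c) and y is unranked. *)
Definition update1 (n : nat) (r : labeling n) (x y : 'I_n) (s : state n) :
    comp (bool * state n) :=
  charge (1 + cmp_cost r (lab s x) (lab s y))
    (if (rho r (lab s x) < rho r (lab s y))%O then
       let l := new_label r s x y in
       charge (1 + size l)
         (if l == lab s y then ret (false, s)
          else ret (true,
            State (out s)
              (set_at (same s) y (if l == lab s x then [:: x] else [::]))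
              (set_at (lab s) y l)))
     else if lab s x == lab s y then charge 1 (ret (false, add_same x y s))
     else ret (false, s)).

(* The stack todo of pending calls realizes the recursion: the calls issued by
   Update(x, y) are completed before the calls that were already pending. *)
Fixpoint update (n : nat) (r : labeling n) (fuel : nat)
    (todo : seq ('I_n * 'I_n)) (s : state n) : comp (state n) :=
  if todo is (x, y) :: todo' then
    if fuel is fuel'.+1 then
      let! p := update1 r x y s in
      let calls := if p.1 then [seq (y, w) | w <- out s y] else [::] in
      update r fuel' (calls ++ todo') p.2
    else None
  else ret s.

(* The result None means that a cycle is reported. *)
Definition insert (n : nat) (r : labeling n) (fuel : nat) (u v : 'I_n)
    (s : state n) : comp (option (state n)) :=
  let s' := add_arc u v s in
  charge (1 + cmp_cost r (lab s u) (lab s v))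
    (if (rho r (lab s v) < rho r (lab s u))%O then ret (Some s') else
     let! b := bsearch s v fuel [:: u] [set u] in
     if b.1 then ret None else
     if (rho r (lab s u) < rho r (lab s v))%O then
       let! c := fsearch r s u b.2 fuel [:: v] [set v] in
       if c then ret None else
       let! t := update r fuel [:: (u, v)] s' in ret (Some t)
     else charge 1 (ret (Some (add_same u v s')))).

(* The boolean tells whether a cycle was reported, after which the algorithm
   halts. *)
Fixpoint process (n : nat) (r : labeling n) (fuel : nat)
    (arcs : seq ('I_n * 'I_n)) (s : state n) : comp bool :=
  if arcs is (u, v) :: arcs' then
    let! o := insert r fuel u v s in
    if o is Some t then process r fuel arcs' t else ret true
  else ret false.

(* On this input and labeling the algorithm terminates after c steps.  The
   fuel only bounds the number of loop iterations and has no influence on c. *)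
Definition runs_in (n : nat) (r : labeling n) (arcs : seq ('I_n * 'I_n))
    (c : nat) : Prop :=
  exists fuel b, process r fuel arcs (init r) = Some (b, c).

(* Main.v *)
(** Extending the label of [x] along an arc [x -> y] is monotone, so the label of
    [y] is the lexicographic minimum of the labels of the single paths to [y].  A
    pruned call of Update would change no label further down; hence the stored
    labels are, at any time, the minima over a sequence of paths which is fixed
    before the ranks are drawn, namely the one enumerated by the update without
    pruning.  The label of a vertex therefore changes at most as often as a fixed
    sequence of paths has records.

    For any fixed sequence of paths of a DAG through [N] ranked vertices the
    expected number of records is at most [N + 1].  Condition on the vertex [m] of
    minimum rank: the records before the first path through [m] only see vertices
    which occur earlier than [m], later records are records of the suffixes after
    [m], which only see vertices below [m].  Averaged over [m] this is the quicksort
    recurrence; weighting a record by the length of its label costs a harmonic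
    factor.

    A backward search from [u] stays in the class of vertices with the label of [u].
    This class lies between the last entry [x] of the label and [u], where no vertex
    but [x] is ranked, so it has [O(log n / q)] vertices with high probability. *)

Require Import Defs.
From mathcomp Require Import all_boot all_order all_algebra.
From mathcomp Require Import all_classical all_reals all_analysis.
From mathcomp Require Import perm.
From mathcomp Require Import zify ring lra.

Import Defs.
Import Order.TTheory GRing.Theory Num.Theory.

Set Implicit Arguments.
Unset Strict Implicit.
Unset Printing Implicit Defensive.

Local Open Scope nat_scope.

(** * Labels of paths *)

Section Labels.
Variables (n : nat) (r : labeling n).
Implicit Types (x y z : 'I_n) (l p : seq 'I_n).

(** The exponents come from a balance. An arc pays for the records at its two ends, about
    [n q log n] steps in expectation, and for one backward search in a class of about [log n / q]
    vertices; the lists [same] stay inside the class, so this search costs at most the square of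
    that size. With [q] the cube root of [log n / n] both terms are [n^(2/3) (log n)^(4/3)]. The
    obstacle is that the control flow depends on the ranks, while records can be averaged only over
    paths chosen without them. Hence the run is compared step by step with the unpruned update, and
    costs are moved onto the records of the latter. The forward search fits in because every vertex
    that it expands loses its label in the update that follows; a potential made of record weights
    and current label sizes carries this over. A search that ends in a cycle report has no update to
    pay for it, but it occurs only once. *)

Definition rank_inj := {in ranked r &, injective (rank r)}.

Lemma rank_ltn x : (rank r x < n) = (x \in ranked r).
Proof. by rewrite inE /rank; case: (r x) => [i|] /=; rewrite ?ltn_ord ?ltnn. Qed.

Lemma rank_le x : rank r x <= n.
Proof. by rewrite /rank; case: (r x) => // i; apply: ltnW. Qed.

Lemma labelings_rank_inj : r \in labelings n -> rank_inj.
Proof.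
rewrite inE /rankings inE => /andP[_ /dinjectiveP rI] x y.
move=> xr yr; move: (xr) (yr); rewrite !inE /rank => + + E.
case rx: (r x) E => [i|//]; case ry: (r y) => [j|//] /ord_inj ij _ _.
by apply: rI => //; rewrite rx ry ij.
Qed.

Definition own y : seq 'I_n := if y \in ranked r then [:: y] else [::].

Fixpoint extend y l : seq 'I_n :=
  if l is z :: l' then
    if rank r y <= rank r z then own y else z :: extend y l'
  else own y.

(** On a path without repetitions, with injective ranks, these are the suffix minima: the ranked
    vertices whose rank is below that of all later vertices. *)
Definition path_label p : seq 'I_n := foldl (fun l y => extend y l) [::] p.

Lemma path_label_rcons p y : path_label (rcons p y) = extend y (path_label p).
Proof. by rewrite /path_label foldl_rcons. Qed.

Definition rankeds l := {subset l <= ranked r}.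

Lemma rankeds_cons z l : rankeds (z :: l) <-> z \in ranked r /\ rankeds l.
Proof.
split=> [h|[h1 h2] x].
  split=> [|x xl]; apply: h; first exact: mem_head.
  by rewrite in_cons xl orbT.
by rewrite in_cons => /predU1P[->|xl]; [|apply: h2].
Qed.

Lemma own_sub y z : z \in own y -> z = y /\ y \in ranked r.
Proof. by rewrite /own; case: ifP => // yr; rewrite inE => /eqP. Qed.

Lemma mem_extend y l z : z \in extend y l -> z \in l \/ z = y /\ y \in ranked r.
Proof.
elim: l => [|x l IH] /=; first by move/own_sub; right.
case: ifP => _; first by move/own_sub; right.
by rewrite !in_cons => /predU1P[->|/IH[->|]]; rewrite ?eqxx ?orbT; auto.
Qed.

Lemma rankeds_extend y l : rankeds l -> rankeds (extend y l).
Proof. by move=> h z /mem_extend[zl|[->]]; [apply: h|]. Qed.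

Lemma mem_path_label p z : z \in path_label p -> z \in p /\ z \in ranked r.
Proof.
elim/last_ind: p => [//|p y IH]; rewrite path_label_rcons mem_rcons inE.
by case/mem_extend=> [/IH[-> ->]|[-> ->]]; rewrite ?orbT ?eqxx.
Qed.

Lemma rankeds_path_label p : rankeds (path_label p).
Proof. by move=> z /mem_path_label[]. Qed.

Lemma extend_unranked y l : y \notin ranked r -> rankeds l -> extend y l = l.
Proof.
move=> yr; elim: l => [|z l IH] /=; first by rewrite /own (negbTE yr).
move=> /rankeds_cons[zr lr]; rewrite IH //.
by rewrite leqNgt (leq_trans (n := n)) ?rank_ltn // leqNgt rank_ltn.
Qed.

Lemma extend_ranked y l : y \in ranked r ->
  exists2 q, extend y l = rcons q y & {in q, forall z, rank r z < rank r y}.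
Proof.
move=> yr; elim: l => [|z l [q E h]] /=; first by exists [::]; rewrite // /own yr.
case: leqP => zy; first by exists [::]; rewrite // /own yr.
by exists (z :: q) => [|x]; rewrite ?E // inE => /predU1P[->|/h].
Qed.

Lemma size_extend y l : size (extend y l) <= (size l).+1.
Proof.
have h : size (own y) <= 1 by rewrite /own; case: ifP.
by elim: l => //= z l IH; case: ifP => _ //=; apply: leq_trans h _.
Qed.

Lemma rho_le_cons x l y l' : (rho r (x :: l) <= rho r (y :: l'))%O =
  (rank r x < rank r y) || (rank r x == rank r y) && (rho r l <= rho r l')%O.
Proof.
rewrite [LHS]Order.SeqLexiOrder.Exports.lexi_cons !leEnat.
by case: (ltngtP (rank r x) (rank r y)).
Qed.

Lemma rho_lt_cons x l y l' : (rho r (x :: l) < rho r (y :: l'))%O =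
  (rank r x < rank r y) || (rank r x == rank r y) && (rho r l < rho r l')%O.
Proof.
rewrite [LHS]Order.SeqLexiOrder.Exports.ltxi_cons !leEnat.
by case: (ltngtP (rank r x) (rank r y)).
Qed.

Lemma rho_le_nil l : rankeds l -> (rho r l <= rho r [::])%O.
Proof.
case: l => // z l /rankeds_cons[]; rewrite -rank_ltn => zn _.
rewrite [(_ <= _)%O]Order.SeqLexiOrder.Exports.lexi_cons !leEnat.
by rewrite rank_le /= leqNgt zn.
Qed.

Lemma rho_nil_lt z l : z \in ranked r -> (rho r (z :: l) < rho r [::])%O.
Proof.
rewrite -rank_ltn => zn.
rewrite [(_ < _)%O]Order.SeqLexiOrder.Exports.ltxi_cons !leEnat.
by rewrite rank_le /= leqNgt zn.
Qed.

Lemma rho_nil_le z l : z \in ranked r -> (rho r [::] <= rho r (z :: l))%O = false.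
Proof. by move=> zr; rewrite leNgt rho_nil_lt. Qed.

Lemma rho_inj l l' : rank_inj -> rankeds l -> rankeds l' -> rho r l = rho r l' -> l = l'.
Proof.
move=> rI; elim: l l' => [|x l IH] [|y l'] //.
- by move=> _ /rankeds_cons[yr _] E; have := rho_nil_lt l' yr; rewrite -E ltxx.
- by move=> /rankeds_cons[xr _] _ E; have := rho_nil_lt l xr; rewrite E ltxx.
- move=> /rankeds_cons[xr lr] /rankeds_cons[yr l'r] [/rI-> //].
  by move=> E; rewrite (IH l').
Qed.

(** Every entry of [extend y l0] has rank at most that of [y], so cutting [l] and writing [y] there
    cannot bring [l] below it. The left side is an extension by [y] because it will be the stored
    label of [y], which is how pruned calls are justified. *)
Lemma extend_le_extend y l0 l : rankeds l0 -> rankeds l ->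
  (rho r (extend y l0) <= rho r l)%O ->
  (rho r (extend y l0) <= rho r (extend y l))%O.
Proof.
case: (boolP (y \in ranked r)) => yr; last by move=> h0 h1; rewrite !extend_unranked.
have own_le l' : rankeds l' ->
    (rho r (own y) <= rho r l')%O -> (rho r (own y) <= rho r (extend y l'))%O.
  case: l' => [|z l' _] //=; case: leqP => // zy.
  by rewrite /own yr rho_le_cons ltnNge (ltnW zy) gtn_eqF.
elim: l0 l => [|z0 l0 IH] [|z l] //=.
- by move=> _ zl; apply: own_le.
- move=> /rankeds_cons[z0r _] _; case: leqP => // zy _.
  by rewrite /own yr rho_le_cons zy.
- move=> /rankeds_cons[z0r lr0] zl; case: leqP => z0y; first exact: (own_le (z :: l)).
  rewrite rho_le_cons; case/rankeds_cons: zl => zr lr.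
  case: (leqP (rank r y) (rank r z)) => yz.
    by move=> _; rewrite /own yr rho_le_cons z0y.
  rewrite rho_le_cons => /orP[->//|/andP[-> h]]; rewrite IH ?orbT //.
Qed.

(** An entry replaced by [y] has strictly larger rank, and at the end [y] replaces [+oo]. If [y]
    occurred in [l], cutting behind it would put [+oo] in place of a finite rank. *)
Lemma extend_le y l : rank_inj -> rankeds l -> y \notin l ->
  (rho r (extend y l) <= rho r l)%O.
Proof.
move=> rI; case: (boolP (y \in ranked r)) => yr; last by move=> ?; rewrite extend_unranked.
elim: l => [|z l IH] /=; first by move=> _ _; rewrite /own yr ltW // rho_nil_lt.
move=> /rankeds_cons[zr lr]; rewrite in_cons negb_or => /andP[yz yl].
case: leqP => [|_]; last by rewrite rho_le_cons eqxx IH ?orbT.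
rewrite leq_eqVlt => /predU1P[/rI E|lt]; first by rewrite E ?eqxx in yz.
by rewrite /own yr rho_le_cons lt.
Qed.

Lemma extend_mono y l l' : rank_inj -> rankeds l -> rankeds l' -> y \notin l ->
  (rho r l <= rho r l')%O -> (rho r (extend y l) <= rho r (extend y l'))%O.
Proof.
move=> rI lr l'r yl le; apply: extend_le_extend => //.
by apply: le_trans le; apply: extend_le.
Qed.

(** The last entry is the last ranked vertex of the path; the unranked vertices behind it leave the
    label alone. *)
Lemma last_path_label p q x : path_label p = rcons q x ->
  exists p1 p2, p = rcons p1 x ++ p2 /\ path_label (rcons p1 x) = rcons q x.
Proof.
elim/last_ind: p => [|p y IH]; first by case: q.
rewrite path_label_rcons; case: (boolP (y \in ranked r)) => yr.
  move=> E; have [q' E' _] := extend_ranked (path_label p) yr.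
  have [_ yx] : (q, x) = (q', y) by apply: rcons_inj; rewrite -E -E'.
  by exists p, [::]; rewrite cats0 {1 2}yx path_label_rcons.
rewrite extend_unranked; [|done|exact: rankeds_path_label].
move=> /IH[p1 [p2 [-> E]]]; exists p1, (rcons p2 y); split=> //.
by rewrite rcons_cat.
Qed.

End Labels.

(** * Records *)

Section Records.
Variables (n : nat) (r : labeling n).
Hypothesis rI : rank_inj r.
Implicit Types (p : seq 'I_n) (Q seen : seq (seq 'I_n)).

(* A record is a path whose label is smaller than the labels of all earlier paths;
   [seen] holds the earlier paths. *)
Fixpoint weight c seen Q : nat :=
  if Q is p :: Q' then
    (if all (fun p' => rho r (path_label r p) < rho r (path_label r p'))%O seen
     then c + size (path_label r p) else 0) + weight c (p :: seen) Q'
  else 0.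

Definition after (m : 'I_n) p := drop (index m p).+1 p.

(** The minimum erases all earlier entries and is never erased, so the rest of the label develops as
    on the suffix alone. *)
Lemma path_label_min m p : m \in ranked r -> uniq p -> m \in p ->
  {in p, forall y, rank r m <= rank r y} ->
  path_label r p = m :: path_label r (after m p).
Proof.
move=> mr + mp; rewrite /after; case/splitPr: mp => a b U h.
have ma : m \notin a by move: U; rewrite cat_uniq /= negb_or => /and3P[_ /andP[]].
rewrite index_cat (negbTE ma) /= eqxx addn0.
rewrite -cat_rcons drop_size_cat ?size_rcons //.
rewrite /path_label foldl_cat foldl_rcons.
have -> : extend r m (foldl (fun l y => extend r y l) [::] a) = [:: m].
  case E : (foldl _ _ a) => [|z l] /=; rewrite /own mr // h //.
  have /mem_path_label[za _] : z \in path_label r a by rewrite /path_label E mem_head.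
  by rewrite mem_cat za.
have : {in b, forall y, rank r m < rank r y}.
  move=> y yb; rewrite ltn_neqAle h ?mem_cat ?inE ?yb ?orbT // andbT.
  apply/eqP => E; have yr : y \in ranked r by rewrite -rank_ltn -E rank_ltn.
  by move: U; rewrite (rI mr yr E) cat_uniq /= yb => /and3P[].
elim/last_ind: b {U h} => [|b y IH] // h.
rewrite !foldl_rcons IH => [|z zb]; last by apply: h; rewrite mem_rcons inE zb orbT.
by rewrite /= leqNgt h // mem_rcons mem_head.
Qed.

Lemma path_label_not_min m p q : m \in ranked r -> m \notin p ->
  {in p, forall y, rank r m <= rank r y} ->
  (rho r (path_label r p) < rho r (m :: q))%O = false.
Proof.
move=> mr mp h; case E: (path_label r p) => [|z l].
  by apply/negbTE; rewrite -leNgt ltW // rho_nil_lt.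
have /mem_path_label[zp zr]: z \in path_label r p by rewrite E mem_head.
rewrite rho_lt_cons ltnNge h //=; case: eqP => //= /rI zm.
by rewrite -zm // zp in mp.
Qed.

Section Split.
Variable m : 'I_n.
Hypothesis mr : m \in ranked r.

Definition min_paths Q := {in Q, forall p, uniq p /\ {in p, forall y, rank r m <= rank r y}}.

Definition afters Q := [seq after m p | p <- Q & m \in p].

(** Once a path through [m] has been seen, a record must start with [m]. Comparing two labels that
    start with [m] means comparing the suffixes; the entry stripped off moves into the constant,
    hence [c.+1]. *)
Lemma weight_after c seen Q : min_paths (seen ++ Q) ->
  has (fun p => m \in p) seen ->
  weight c seen Q <= weight c.+1 (afters seen) (afters Q).
Proof.
elim: Q seen => //= p Q IH seen hQ hs.
have [Up pm] : uniq p /\ {in p, forall y, rank r m <= rank r y}.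
  by apply: hQ; rewrite mem_cat mem_head orbT.
have := IH (p :: seen); rewrite /= hs orbT.
have hQ' : min_paths (p :: seen ++ Q).
  by move=> q qQ; apply: hQ; move: qQ; rewrite mem_cat !inE mem_cat orbCA.
move=> /(_ hQ' isT); rewrite /afters /=; case: ifP => mp /= h.
  rewrite leq_add //; case: ifP => // hrec; rewrite ifT.
    by rewrite (path_label_min mr Up mp pm) /= addSnnS.
  rewrite /afters all_map all_filter; apply/allP => q' q's /=; apply/implyP => mq'.
  have [Uq' q'm] : uniq q' /\ {in q', forall y, rank r m <= rank r y}.
    by apply: hQ; rewrite mem_cat q's.
  move/allP: hrec => /(_ _ q's).
  by rewrite (path_label_min mr Up mp pm) (path_label_min mr Uq' mq' q'm) rho_lt_cons ltnn eqxx.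
case: ifP => // /allP hrec; case/hasP: hs => q' q's mq'.
have [Uq' q'm] : uniq q' /\ {in q', forall y, rank r m <= rank r y}.
  by apply: hQ; rewrite mem_cat q's.
by have := hrec _ q's; rewrite (path_label_min mr Uq' mq' q'm) path_label_not_min ?mp.
Qed.

(** The first path through [m] separates the two terms. It is counted as a record of the suffixes in
    any case, which is why the second term starts with nothing seen. *)
Lemma weight_split c seen Q : min_paths (seen ++ Q) ->
  ~~ has (fun p => m \in p) seen ->
  weight c seen Q <= weight c seen (take (find (fun p => m \in p) Q) Q)
                     + weight c.+1 [::] (afters Q).
Proof.
elim: Q seen => //= p Q IH seen hQ hs.
have [Up pm] : uniq p /\ {in p, forall y, rank r m <= rank r y}.
  by apply: hQ; rewrite mem_cat mem_head orbT.
have hQ' : min_paths (p :: seen ++ Q).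
  by move=> q qQ; apply: hQ; move: qQ; rewrite mem_cat !inE mem_cat orbCA.
rewrite /afters /= -/(afters Q); case: (boolP (m \in p)) => mp /=; last first.
  by rewrite -addnA leq_add2l; apply: IH => //=; rewrite (negbTE mp).
rewrite add0n leq_add //; first by case: ifP; rewrite // (path_label_min mr Up mp pm) /= addnS.
have := @weight_after c (p :: seen) Q hQ'; rewrite /= mp => /(_ isT).
rewrite {1}/afters /= mp; congr (_ <= _); congr (weight _ (_ :: _)).
rewrite (eq_in_filter (a2 := pred0)) ?filter_pred0 // => q qs.
by apply/negbTE; apply: contra hs => mq; apply/hasP; exists q.
Qed.
End Split.

Lemma weight_cat c seen Q1 Q2 :
  weight c seen (Q1 ++ Q2) = weight c seen Q1 + weight c (catrev Q1 seen) Q2.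
Proof. by elim: Q1 seen => //= p Q1 IH seen; rewrite IH addnA. Qed.

(** The first path of [Q] that attains the minimum [l] is a record. *)
Lemma weight_new c seen Q l :
  (exists2 p, p \in Q & path_label r p = l) ->
  {in Q, forall p, (rho r l <= rho r (path_label r p))%O} ->
  {in seen, forall p, (rho r l < rho r (path_label r p))%O} ->
  c + size l <= weight c seen Q.
Proof.
elim: Q seen => [|p Q IH] seen [q //]; rewrite inE => qQ ql hQ hs /=.
have lr : rankeds r l by rewrite -ql; apply: rankeds_path_label.
have := hQ _ (mem_head _ _); rewrite le_eqVlt => /predU1P[E|lt].
  have {}E := rho_inj rI lr (@rankeds_path_label n r p) E.
  by rewrite -E ifT ?leq_addr //; apply/allP => s /hs.
apply: leq_trans (leq_addl _ _); apply: IH.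
- exists q => //; move: qQ => /predU1P[E|//].
  by move: lt; rewrite -E ql ltxx.
- by move=> s sQ; apply: hQ; rewrite inE sQ orbT.
- by move=> s; rewrite inE => /predU1P[->|/hs].
Qed.

End Records.

(** * Random rankings *)

Section Average.
Variable R : realFieldType.

Definition harmonic (N : nat) : R := (\sum_(i < N) i.+1%:R^-1)%R.

Lemma harmonicS N : harmonic N.+1 = (harmonic N + N.+1%:R^-1)%R.
Proof. by rewrite /harmonic big_ord_recr. Qed.

Lemma harmonic_ge0 N : (0 <= harmonic N)%R.
Proof. by apply: sumr_ge0 => i _; rewrite invr_ge0 ler0n. Qed.

Lemma harmonic_le : {homo harmonic : M N / M <= N >-> (M <= N)%R}.
Proof.
apply: homo_leq => [x //|y x z|i]; first exact: le_trans.
by rewrite harmonicS lerDl invr_ge0 ler0n.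
Qed.

(* Solves the quicksort recurrence of [sum_weight_bound]. *)
Definition weight_bound (c N : nat) : R := (N.+1%:R * (c%:R + harmonic N))%R.

Lemma weight_bound_le c : {homo weight_bound c : M N / M <= N >-> (M <= N)%R}.
Proof.
move=> M N MN; apply: ler_pM; rewrite ?ler0n ?addr_ge0 ?harmonic_ge0 ?ler0n //.
  by rewrite ler_nat ltnS.
by rewrite lerD2l harmonic_le.
Qed.

(** In the induction step the terms [c.+1] cost an extra [N.+1], while the new harmonic term,
    multiplied by [N.+1 * N.+2], gains [N.+2]. *)
Lemma sum_weight_bound c N :
  (\sum_(i < N) (weight_bound c i + weight_bound c.+1 i) <= N%:R * weight_bound c N)%R.
Proof.
elim: N => [|N IH]; first by rewrite big_ord0 mul0r.
rewrite big_ord_recr /=; apply: le_trans (lerD IH (lexx _)) _.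
rewrite /weight_bound harmonicS -!natr1.
have N0 : (0 <= N%:R :> R)%R by rewrite ler0n.
have : ((N%:R + 1) * (N%:R + 1)^-1 = 1 :> R)%R by rewrite divff // gt_eqF //; lra.
move: (_^-1)%R => x; set t := N%:R%R in N0 *; move=> E.
have : ((t + 1) * ((t + 1 + 1) * (c%:R + (harmonic N + x))) =
  (t + 1) * (t + 1 + 1) * (c%:R + harmonic N) + (t + 1 + 1) * ((t + 1) * x))%R by ring.
rewrite E => ->; nra.
Qed.

(** With distinct keys the cardinals are exactly [0, ..., #|V| - 1]; ties only make them smaller. *)
Lemma sum_by_key (T : finType) (k : T -> nat) (f : nat -> R) (V : {set T}) :
  {homo f : i j / i <= j >-> (i <= j)%R} ->
  (\sum_(m in V) f #|finset (fun y => (y \in V) && (k y < k m)%N)|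
     <= \sum_(i < #|V|) f i)%R.
Proof.
move=> fh; move E : #|V| => N; elim: N V E => [|N IH] V E.
  by rewrite (cards0_eq E) big_set0 big_ord0.
have /card_gt0P[m0 m0V] : 0 < #|V| by rewrite E.
have [m /= mV mmax] := arg_maxnP k m0V; have {}mV : m \in V := mV.
have E' : #|V :\ m| = N by move: (cardsD1 m V); rewrite mV E => -[].
rewrite (big_setD1 m) //= big_ord_recr /= addrC lerD //.
  apply: le_trans (IH _ E'); apply: ler_sum => x; rewrite !inE => /andP[xm xV].
  apply: fh; apply: subset_leq_card; apply/fintype.subsetP => y; rewrite !inE.
  move=> /andP[yV yx]; rewrite yV yx !andbT; apply: contraTN yx => /eqP->.
  by rewrite -leqNgt; apply: mmax.
apply: fh; rewrite -E'; apply: subset_leq_card; apply/fintype.subsetP => y; rewrite !inE.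
by move=> /andP[-> ym]; rewrite andbT; apply: contraTN ym => /eqP->; rewrite ltnn.
Qed.

End Average.

(** * Exchange symmetry of random rankings *)

Section Swap.
Variable n : nat.
Implicit Types (r : labeling n) (V : {set 'I_n}) (K : {set labeling n}).

Definition swap (a b : 'I_n) r : labeling n := [ffun v => r (tperm a b v)].

Lemma swap_inj a b : injective (swap a b).
Proof.
move=> r r' /ffunP h; apply/ffunP => v; have := h (tperm a b v).
by rewrite !ffunE tpermK.
Qed.

Lemma rank_swap a b r v : rank (swap a b r) v = rank r (tperm a b v).
Proof. by rewrite /rank ffunE. Qed.

(** Replaces conditional uniformity: in a class of rankings closed under these transpositions each
    vertex of [V] is equally often the minimum of [V]. *)
Definition swap_closed V K := forall a b r, a \in V -> b \in V -> r \in K -> swap a b r \in K.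

Lemma tperm_in a b V x : a \in V -> b \in V -> x \in V -> tperm a b x \in V.
Proof. by move=> aV bV xV; case: tpermP. Qed.

Lemma rankings_inj r L : r \in rankings L -> ranked r = L /\ rank_inj r.
Proof.
move=> rL; have E : ranked r = L by move: rL; rewrite inE => /andP[/eqP].
by split=> //; apply: labelings_rank_inj; rewrite inE E.
Qed.

Lemma swap_closed_rankings L : swap_closed L (rankings L).
Proof.
move=> a b r aL bL; rewrite !inE => /andP[/eqP rL /dinjectiveP rI].
have tL x : (tperm a b x \in L) = (x \in L).
  by case: tpermP => [->|->|//]; rewrite aL bL.
apply/andP; split.
  apply/eqP/setP => v; rewrite -tL -rL !inE ffunE //.
apply/dinjectiveP => x y xL yL; rewrite !ffunE => /rI E.
by apply: (@perm_inj _ (tperm a b)); apply: E; rewrite tL.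
Qed.

Definition minimal_at V K m := [set r in K | [forall x in V, rank r m <= rank r x]].

Section Minimal.
Variables (L V : {set 'I_n}) (K : {set labeling n}).
Hypotheses (VL : V \subset L) (KL : K \subset rankings L) (KV : swap_closed V K).

Lemma swap_minimal m m' r : m \in V -> m' \in V -> r \in minimal_at V K m ->
  swap m m' r \in minimal_at V K m'.
Proof.
move=> mV m'V; rewrite !inE => /andP[rK /forall_inP h].
rewrite KV //=; apply/forall_inP => x xV; rewrite !rank_swap tpermR h //.
exact: tperm_in.
Qed.

Lemma card_minimal m m' : m \in V -> m' \in V -> #|minimal_at V K m| = #|minimal_at V K m'|.
Proof.
wlog suff: m m' / m \in V -> m' \in V -> #|minimal_at V K m| <= #|minimal_at V K m'|.
  by move=> h mV m'V; apply/eqP; rewrite eqn_leq !h.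
move=> mV m'V; rewrite -(card_imset _ (@swap_inj m m')); apply: subset_leq_card.
by apply/fintype.subsetP => _ /imsetP[r rm ->]; apply: swap_minimal.
Qed.

Lemma sum_minimal (R : realFieldType) (X : labeling n -> R) : V != finset.set0 ->
  (\sum_(r in K) X r = \sum_(m in V) \sum_(r in minimal_at V K m) X r)%R.
Proof.
case/set0Pn => m0 m0V.
pose am r := [arg min_(m < m0 in V) rank r m].
have amV r : am r \in V by rewrite /am; case: arg_minnP.
rewrite (partition_big am (mem V)) //=; apply: eq_bigr => m mV.
apply: eq_bigl => r; rewrite inE; case: (boolP (r \in K)) => //= rK.
have [rL rI] := rankings_inj (fintype.subsetP KL _ rK).
apply/eqP/forall_inP => [<- x xV|h]; first by rewrite /am; case: arg_minnP => // i _; apply.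
rewrite /am; case: arg_minnP => // i iV ih.
apply: rI; rewrite ?rL ?(fintype.subsetP VL) //.
by apply/eqP; rewrite eqn_leq h ?ih.
Qed.

Lemma card_minimal_mul m : m \in V -> #|V| * #|minimal_at V K m| = #|K|.
Proof.
move=> mV; have V0 : V != finset.set0 by apply/set0Pn; exists m.
(* Summing the constant 1 turns the partition of the sum into a count. *)
have := @sum_minimal rat (fun=> 1%R) V0; rewrite big_const iter_addr_0.
under eq_bigr => m' m'V do rewrite big_const iter_addr_0 (card_minimal m'V mV).
rewrite big_const iter_addr_0 -mulrnA => /eqP.
by rewrite eqr_nat mulnC => /eqP.
Qed.

Lemma swap_closed_minimal V' m : V' \subset V -> m \notin V' ->
  swap_closed V' (minimal_at V K m).
Proof.
move=> V'V mV' a b r aV' bV'; rewrite !inE => /andP[rK /forall_inP h].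
have aV := fintype.subsetP V'V _ aV'; have bV := fintype.subsetP V'V _ bV'.
rewrite KV //=; apply/forall_inP => x xV; rewrite !rank_swap tpermD ?h ?tperm_in //.
  by apply: contraNneq mV' => <-.
by apply: contraNneq mV' => <-.
Qed.

End Minimal.
End Swap.

(** * Expected weight of the records of a fixed list of paths *)

Section AverageWeight.
Variables (R : realFieldType) (n : nat) (key : 'I_n -> nat) (L : {set 'I_n}).
Implicit Types (p : seq 'I_n) (Q : seq (seq 'I_n)) (V : {set 'I_n}).

(** [key] plays the part of a topological order: arcs lead to smaller keys, so what follows [m] on a
    path lies below [m]. *)
Definition descending p := sorted (fun x y => key y < key x) p.

Definition within V Q :=
  forall p, p \in Q -> descending p /\ forall y, y \in p -> y \in L -> y \in V.

Lemma descending_uniq p : descending p -> uniq p.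
Proof.
by apply: sorted_uniq => [y x z /= h1 h2|x /=]; [apply: ltn_trans h2 h1|rewrite ltnn].
Qed.

Lemma descending_trans : transitive (fun x y => key y < key x).
Proof. by move=> y x z /= h1 h2; apply: ltn_trans h2 h1. Qed.

Lemma descending_after m p : descending p -> m \in p ->
  descending (after m p) /\ {in after m p, forall y, key y < key m}.
Proof.
move=> dp mp; split; first exact: drop_sorted.
move: dp; rewrite /after; case/splitPr: mp => a b dp; move: (dp).
rewrite /descending sorted_cat_cons => /andP[_ pb].
have U : m \notin a by have := descending_uniq dp; rewrite cat_uniq /= negb_or => /and3P[_ /andP[]].
rewrite index_cat (negbTE U) /= eqxx addn0 -cat_rcons drop_size_cat ?size_rcons //.
by move/allP: (order_path_min descending_trans pb) => h y /h.
Qed.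

Lemma within_sub V V' Q Q' : within V Q -> {subset Q' <= Q} ->
  (forall p y, p \in Q' -> y \in p -> y \in L -> y \in V -> y \in V') -> within V' Q'.
Proof.
move=> h sQ h' p pQ; have [dp pV] := h _ (sQ _ pQ); split=> // y yp yL.
exact: h' pQ yp yL (pV _ yp yL).
Qed.

(** A vertex on a path before the first path through [m] occurs for the first time earlier than [m].
    The index of the first occurrence thus serves as the key for the first half of the
    recurrence. *)
Lemma within_before V Q m : within V Q ->
  within (finset (fun y => (y \in V) && (find (fun p => y \in p) Q < find (fun p => m \in p) Q)))
    (take (find (fun p => m \in p) Q) Q).
Proof.
move=> h; apply: within_sub h (fun p => @mem_take _ _ _ p) _ => p y.
set k := find _ _ => pQ yp _ yV; rewrite inE yV /=.
have ip : index p Q < k.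
  rewrite /k ltnNge; apply/negP => le; move: pQ.
  by apply/negP; rewrite in_take_leq ?find_size // -leqNgt.
apply: leq_ltn_trans ip; rewrite leqNgt; apply/negP => /(before_find p).
by rewrite nth_index ?yp //; apply: mem_take pQ.
Qed.

Lemma within_after V Q m : within V Q ->
  within (finset (fun y => (y \in V) && (key y < key m))) (afters m Q).
Proof.
move=> h _ /mapP[p + ->]; rewrite mem_filter => /andP[mp pQ].
have [dp pV] := h _ pQ; have [da am] := descending_after dp mp; split=> // y ya yL.
by rewrite inE am // pV // (mem_drop ya).
Qed.

Lemma weight_seen_nil (r : labeling n) c seen Q : [::] \in [seq path_label r p | p <- seen] ->
  {in Q, forall p, path_label r p = [::]} -> weight r c seen Q = 0.
Proof.
elim: Q seen => //= p Q IH seen hs hQ.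
rewrite IH ?inE ?hs ?orbT // => [|q qQ]; last by apply: hQ; rewrite inE qQ orbT.
rewrite ifF //; apply/negbTE/negP => /allP h; move: hs => /mapP[q qs q0].
by have := h _ qs; rewrite -q0 hQ ?mem_head // ltxx.
Qed.

Lemma weight_nil (r : labeling n) c Q : {in Q, forall p, path_label r p = [::]} ->
  weight r c [::] Q <= c.
Proof.
case: Q => //= p Q hQ; rewrite weight_seen_nil /= ?hQ ?mem_head // ?addn0 // => q qQ.
by apply: hQ; rewrite inE qQ orbT.
Qed.

(* Conditioning on the minimum of [V] only destroys the symmetry at the minimum, so
   the class [K] of rankings stays closed under swaps inside the smaller vertex sets. *)
Lemma sum_weight V (K : {set labeling n}) Q (c : nat) :
  V \subset L -> K \subset rankings L -> swap_closed V K ->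
  within V Q ->
  (\sum_(r in K) (weight r c [::] Q)%:R <= weight_bound R c #|V| * #|K|%:R)%R.
Proof.
move E : #|V| => N; elim/ltn_ind: N V E K Q c => N IH V E K Q c VL KL KV hQ.
have KI r : r \in K -> ranked r = L /\ rank_inj r.
  by move=> rK; apply: rankings_inj (fintype.subsetP KL _ rK).
have [V0|Vn0] := eqVneq V finset.set0.
  rewrite mulr_natr -sumr_const; apply: ler_sum => r rK.
  have -> : N = 0 by rewrite -E V0 cards0.
  rewrite /weight_bound /harmonic big_ord0 addr0 mul1r ler_nat; apply: weight_nil => p pQ.
  case El: path_label => [//|z l]; have [_ h] := hQ p pQ.
  have /mem_path_label[zp zr] : z \in path_label r p by rewrite El mem_head.
  by have := h z zp; rewrite V0 inE -(KI r rK).1 => /(_ zr).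
rewrite (sum_minimal VL KL) //.
pose first (y : 'I_n) := find (fun p => y \in p) Q.
pose v1 (m : 'I_n) := #|finset (fun y => (y \in V) && (first y < first m))|.
pose v2 m := #|finset (fun y => (y \in V) && (key y < key m))|.
have [m0 m0V] : exists m0, m0 \in V by apply/set0Pn.
set k := #|minimal_at V K m0|.
have kK : (#|K|%:R = N%:R * k%:R :> R)%R.
  by rewrite -natrM -E (card_minimal_mul VL KL KV).
have step m : m \in V ->
  (\sum_(r in minimal_at V K m) (weight r c [::] Q)%:R <=
   weight_bound R c (v1 m) * k%:R + weight_bound R c.+1 (v2 m) * k%:R)%R.
  move=> mV; have km : #|minimal_at V K m| = k by apply: card_minimal.
  have mK : minimal_at V K m \subset K.
    by apply/fintype.subsetP => r; rewrite inE => /andP[].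
  have ltV (k' : 'I_n -> nat) : let V' := finset (fun y => (y \in V) && (k' y < k' m)) in
      [/\ #|V'| < N, V' \subset V & m \notin V'].
    move=> V'; have sV : V' \subset V by apply/fintype.subsetP => y; rewrite inE => /andP[].
    have mV' : m \notin V' by rewrite inE ltnn andbF.
    split=> //; rewrite -E; apply: proper_card; apply/properP; split=> //.
    by exists m.
  have [lt1 s1 n1] := ltV (fun y => find (fun p => y \in p) Q).
  have [lt2 s2 n2] := ltV key.
  have h1 := IH _ lt1 _ erefl _ _ c (fintype.subset_trans s1 VL) (fintype.subset_trans mK KL)
    (swap_closed_minimal KV s1 n1) (within_before (m := m) hQ).
  have h2 := IH _ lt2 _ erefl _ _ c.+1 (fintype.subset_trans s2 VL) (fintype.subset_trans mK KL)
    (swap_closed_minimal KV s2 n2) (within_after (m := m) hQ).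
  rewrite -km; apply: le_trans (lerD h1 h2); rewrite -big_split /=.
  apply: ler_sum => r; rewrite inE => /andP[rK /forall_inP rm].
  have [rL rI] := KI r rK.
  rewrite -natrD ler_nat; apply: weight_split => //.
    by rewrite rL (fintype.subsetP VL).
  move=> p pQ; have [dp pV] := hQ p pQ; split; first exact: descending_uniq.
  (* Vertices outside [L] have rank [+oo], so a minimum over [V] is a minimum over the whole
     path. *)
  move=> y yp; case: (boolP (y \in L)) => yL; first by apply: rm; apply: pV.
  by rewrite (leq_trans (rank_le r m)) // leqNgt rank_ltn rL.
(* All minima are equally frequent, so the two halves can be summed over [m] separately, each with
   its own key. *)
apply: le_trans (ler_sum _ step) _; rewrite big_split /= -!mulr_suml -mulrDl.
rewrite kK mulrA [(weight_bound _ _ _ * _)%R]mulrC ler_wpM2r ?ler0n //.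
apply: le_trans (sum_weight_bound R c N); rewrite big_split /= -E.
by apply: lerD; apply: sum_by_key; apply: weight_bound_le.
Qed.

End AverageWeight.

(** * Histories and updates *)

Section Histories.
Variables (n : nat).
Implicit Types (o : 'I_n -> seq 'I_n) (H : 'I_n -> seq (seq 'I_n)).

Definition arrow o : rel 'I_n := fun x y => y \in o x.

Definition acyclic o := forall x y, y \in o x -> ~~ connect (arrow o) y x.

(* [H y] lists the paths to [y] met so far by the unpruned update, whose control flow
   does not depend on the ranks. *)
Definition hist_add x y H := set_at H y (H y ++ [seq rcons p y | p <- H x]).

Fixpoint hist_update k o x y H :=
  if k is k'.+1 then foldl (fun H' w => hist_update k' o y w H') (hist_add x y H) (o y) else H.

Definition valid o H :=
  forall y p, p \in H y -> exists2 q, p = rcons q y & sorted (arrow o) p.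

Lemma set_at_same (A : Type) (f : 'I_n -> A) y a : set_at f y a y = a.
Proof. by rewrite /set_at eqxx. Qed.

Lemma set_at_other (A : Type) (f : 'I_n -> A) y a z : z != y -> set_at f y a z = f z.
Proof. by rewrite /set_at => /negbTE->. Qed.

Lemma valid_hist_add o x y H : y \in o x -> valid o H -> valid o (hist_add x y H).
Proof.
move=> xy hH z p; rewrite /hist_add; have [->|zy] := eqVneq z y; last first.
  by rewrite set_at_other //; apply: hH.
rewrite set_at_same mem_cat => /orP[/hH//|/mapP[p' /hH[q -> sq] ->]].
exists (rcons q x) => //; case: q sq => [|a q] /=; first by rewrite /arrow xy.
move=> sq; by rewrite rcons_path last_rcons sq.
Qed.

Lemma valid_hist_update o k x y H : y \in o x -> valid o H -> valid o (hist_update k o x y H).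
Proof.
elim: k x y H => //= k IH x y H xy hH.
have : {subset o y <= o y} by [].
elim: {-2}(o y) (hist_add x y H) (valid_hist_add xy hH) => //= w ws IHw H' hH' sub.
by apply: IHw => [|z zs]; [apply: IH => //|]; apply: sub; rewrite inE ?eqxx ?zs ?orbT.
Qed.

Lemma hist_update_cat o k x y H z : exists B, hist_update k o x y H z = H z ++ B.
Proof.
elim: k x y H => [|k IH] x y H /=; first by exists [::]; rewrite cats0.
have [B0 EB] : exists B, hist_add x y H z = H z ++ B.
  rewrite /hist_add /set_at; case: eqP => [->|_]; first by eexists.
  by exists [::]; rewrite cats0.
elim: (o y) (hist_add x y H) B0 EB => /= [|w ws IHw] H' B EB; first by exists B.
have [B' EB'] := IH y w H'; apply: (IHw _ (B ++ B')).
by rewrite EB' EB catA.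
Qed.

Lemma sorted_connect (e : rel 'I_n) q x z :
  sorted e (rcons q x) -> z \in rcons q x -> connect e z x.
Proof.
move=> + zq; have E : last z (rcons q x) = x by rewrite last_rcons.
move: E; case/splitPr: zq => a b; rewrite last_cat /= sorted_cat_cons => E /andP[_ pb].
by apply/connectP; exists b.
Qed.

End Histories.

Section Costs.
Variables (n : nat) (r : labeling n).

Lemma size_lcp (T : eqType) (s t : seq T) : size (lcp s t) <= size s.
Proof. by elim: s t => [|x s IH] [|y t] //=; case: ifP => //= _; rewrite ltnS IH. Qed.

Lemma lcp_prefix (T : eqType) (s t : seq T) : s = lcp s t ++ drop (size (lcp s t)) s.
Proof. by elim: s t => [|x s IH] [|y t] //=; case: ifP => //= _; rewrite -IH. Qed.

Lemma mem_lcp (T : eqType) (s t : seq T) z : z \in lcp s t -> z \in s /\ z \in t.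
Proof.
elim: s t => [|x s IH] [|y t] //=; case: eqP => // <-.
by rewrite !inE => /predU1P[->|/IH[-> ->]]; rewrite ?eqxx ?orbT.
Qed.

Lemma lcpC (T : eqType) (s t : seq T) : lcp s t = lcp t s.
Proof.
elim: s t => [|x s IH] [|y t] //=; rewrite eq_sym; case: eqP => // ->; by rewrite IH.
Qed.

Lemma size_rho l : size (rho r l : seq nat) = (size l).+1.
Proof. by rewrite size_rcons size_map. Qed.

Lemma cmp_cost_l l l' : cmp_cost r l l' <= size l + 2.
Proof. by rewrite /cmp_cost addn2 ltnS -size_rho size_lcp. Qed.

Lemma cmp_cost_r l l' : cmp_cost r l l' <= size l' + 2.
Proof. by rewrite /cmp_cost lcpC addn2 ltnS -size_rho size_lcp. Qed.

Lemma charge_charge (A : Type) a b (m : Defs.comp A) : charge a (charge b m) = charge (a + b) m.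
Proof. by case: m => [[x c]|] //=; rewrite addnA. Qed.

Lemma charge_zero (A : Type) (m : Defs.comp A) : charge 0 m = m.
Proof. by case: m => [[]|]. Qed.

Lemma bind_ret (A B : Type) c (x : A) (f : A -> Defs.comp B) :
  bind (charge c (ret x)) f = charge c (f x).
Proof. by rewrite /= addn0. Qed.

Lemma extend_take y l :
  extend r y l = take (find (fun z => rank r y <= rank r z) l) l ++ own r y.
Proof. by elim: l => [|z l IH] //=; case: ifP => //= _; rewrite IH. Qed.

Lemma extend_cat y p l : {in p, forall z, rank r z < rank r y} ->
  extend r y (p ++ l) = p ++ extend r y l.
Proof.
elim: p => //= z p IH h; rewrite leqNgt h ?mem_head //= IH // => w wp.
by apply: h; rewrite inE wp orbT.
Qed.

End Costs.

Section Update.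
Variables (n : nat) (r : labeling n) (o : 'I_n -> seq 'I_n).
Hypothesis rI : rank_inj r.
Hypothesis oA : acyclic o.
Implicit Types (s : state n) (H : 'I_n -> seq (seq 'I_n)).
Notation reach := (connect (arrow o)).

Definition stored (lb : 'I_n -> seq 'I_n) H := forall y,
  (exists2 p, p \in H y & path_label r p = lb y) /\
  {in H y, forall p, (rho r (lb y) <= rho r (path_label r p))%O}.

(** Brings the stored label into the form that [extend_le_extend] asks for on its left side. *)
Lemma stored_extend lb H y : valid o H -> stored lb H ->
  exists2 l0, rankeds r l0 & lb y = extend r y l0.
Proof.
move=> vH /(_ y)[[p pH <-] _]; have [q -> _] := vH _ _ pH.
by exists (path_label r q); [apply: rankeds_path_label|rewrite path_label_rcons].
Qed.

Lemma stored_rankeds lb H y : stored lb H -> rankeds r (lb y).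
Proof. by move=> /(_ y)[[p _ <-] _]; apply: rankeds_path_label. Qed.

Lemma stored_reach lb H x y : valid o H -> stored lb H -> y \in lb x -> reach y x.
Proof.
move=> vH /(_ x)[[p pH <-] _] /mem_path_label[yp _].
by have [q E sq] := vH _ _ pH; rewrite E in sq yp; apply: sorted_connect yp.
Qed.

(** The pruned call: the history grows while the label stays, because no extension of a path to [x]
    falls below the label of [y]. *)
Lemma stored_hist_add lb H x y : valid o H -> stored lb H ->
  (rho r (lb y) <= rho r (lb x))%O -> stored lb (hist_add x y H).
Proof.
move=> vH sH le z; rewrite /hist_add; have [->|zy] := eqVneq z y; last first.
  by rewrite set_at_other.
rewrite set_at_same; have [[p pH pE] mn] := sH y; split.
  by exists p; rewrite // mem_cat pH.
move=> p'; rewrite mem_cat => /orP[/mn//|/mapP[q qH ->]].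
have [l0 l0r E] := stored_extend y vH sH.
rewrite path_label_rcons E; apply: extend_le_extend => //; first exact: rankeds_path_label.
by rewrite -E; apply: le_trans le _; apply: (sH x).2.
Qed.

(** A whole pruned subtree of calls: if no arc below [y] has anything to pass on, all paths added
    there leave the minima as they are. *)
Lemma stored_hist_update lb k H x y : y \in o x -> valid o H -> stored lb H ->
  (rho r (lb y) <= rho r (lb x))%O ->
  (forall a b, reach y a -> b \in o a -> (rho r (lb b) <= rho r (lb a))%O) ->
  stored lb (hist_update k o x y H).
Proof.
elim: k x y H => //= k IH x y H xy vH sH le hy.
have : {subset o y <= o y} by [].
have := valid_hist_add xy vH; have := stored_hist_add vH sH le.
elim: {-2}(o y) (hist_add x y H) => //= w ws IHw H' sH' vH' sub.
have wy : w \in o y by apply: sub; rewrite mem_head.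
apply: IHw => [||z zs]; last by apply: sub; rewrite inE zs orbT.
  apply: IH => // [|a b wa]; first by apply: hy.
  by apply: hy; apply: connect_trans wa; apply: connect1.
exact: valid_hist_update.
Qed.

Definition tracks s H :=
  [/\ out s = o, valid o H, stored (lab s) H, forall y, uniq (same s y)
    & forall a b, a \in same s b -> b \in o a].

(* An arc is settled when no call of Update along it is outstanding, and pending from
   the moment its tail changes its label until that call is made. *)
Definition settled_arc s a b :=
  (rho r (lab s b) <= rho r (lab s a))%O /\ (a \in same s b) = (lab s a == lab s b).

Definition pending_arc s a b := a \in same s b -> (rho r (lab s a) < rho r (lab s b))%O.

(* Each call along an arc out of [z] costs at most [5 + 2 * size l <= 2 * (3 + size l)],
   with [l] the new label of [z]. *)
Definition mass H := \sum_z size (o z) * 2 * weight r 3 [::] (H z).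

(** The cut never falls inside the common prefix. If [y] is ranked, its label ends with [y] and its
    other entries have smaller rank, and [y] is not in the label of [x] since the graph is
    acyclic. *)
Lemma new_labelE s H x y : y \in o x -> tracks s H -> new_label r s x y = extend r y (lab s x).
Proof.
move=> xy [_ vH sH _ _]; rewrite [in RHS](lcp_prefix (lab s x) (lab s y)) extend_cat.
  by rewrite /new_label extend_take.
move=> z /mem_lcp[zx zy]; have zr := stored_rankeds sH zx.
case: (boolP (y \in ranked r)) => yr; last first.
  by rewrite (@leq_trans n) ?rank_ltn // leqNgt rank_ltn.
have [l0 _ E] := stored_extend y vH sH.
have [q Eq h] := extend_ranked l0 yr.
move: zy; rewrite E Eq mem_rcons inE => /predU1P[zy|/h//].
by have := oA xy; rewrite (stored_reach vH sH (x := x)) // -zy.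
Qed.

(** The new label is a record of the history of [y], and its weight prepays the calls along all arcs
    out of [y]. The list [sm] is left open because it depends on whether the new label equals that
    of [x]. *)
Lemma tracks_lower s H x y : y \in o x -> tracks s H ->
  (rho r (lab s x) < rho r (lab s y))%O -> let l := extend r y (lab s x) in
  [/\ (rho r l <= rho r (lab s x))%O,
    forall sm, {in sm, forall a, a = x} -> uniq sm ->
      tracks (State (out s) (set_at (same s) y sm) (set_at (lab s) y l)) (hist_add x y H)
    & mass H + size (o y) * (2 * (3 + size l)) <= mass (hist_add x y H)].
Proof.
move=> xy [os vH sH us hs] lt l.
have ynx : y \notin lab s x by apply: contra (oA xy); apply: stored_reach vH sH.
have lr : rankeds r l by apply: rankeds_extend; apply: stored_rankeds sH.
have le : (rho r l <= rho r (lab s x))%O by apply: extend_le => //; apply: stored_rankeds sH.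
have lty : (rho r l < rho r (lab s y))%O by apply: le_lt_trans lt.
have lnew : {in [seq rcons p y | p <- H x], forall p, (rho r l <= rho r (path_label r p))%O}.
  move=> _ /mapP[p pH ->]; rewrite path_label_rcons.
  apply: extend_mono => //; [exact: stored_rankeds sH|exact: rankeds_path_label|].
  exact: (sH x).2.
have lold : {in H y, forall p, (rho r l < rho r (path_label r p))%O}.
  by move=> p pH; apply: lt_le_trans lty _; apply: (sH y).2.
have latt : exists2 p, p \in [seq rcons p y | p <- H x] & path_label r p = l.
  have [[p pH pE] _] := sH x; exists (rcons p y); first exact: map_f.
  by rewrite path_label_rcons pE.
split=> //.
  move=> sm smx smu; split=> //=; first exact: valid_hist_add.
  - move=> z; rewrite /hist_add; have [->|zy] := eqVneq z y; last by rewrite !set_at_other.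
    rewrite !set_at_same; have [p pH pE] := latt; split.
      by exists p; rewrite // mem_cat pH orbT.
    by move=> q; rewrite mem_cat => /orP[/lold/ltW|/lnew].
  - by move=> z; have [->|zy] := eqVneq z y; rewrite ?set_at_same // set_at_other.
  - move=> a b; have [->|zy] := eqVneq b y; rewrite ?set_at_same ?set_at_other //.
      by move=> /smx->.
    exact: hs.
rewrite /mass (bigD1 y) //= [X in _ <= X](bigD1 y) //=.
rewrite /hist_add set_at_same weight_cat catrevE cats0.
rewrite addnAC leq_add //; last first.
  by apply: leq_sum => z zy; rewrite set_at_other.
rewrite [X in _ <= X]mulnDr leq_add2l -mulnA !leq_mul2l; apply/orP; right=> /=.
apply: weight_new => // p; rewrite mem_rev; exact: lold.
Qed.

End Update.

(** * Correctness and cost of the recursive update *)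

Section UpdateCalls.
Variables (n : nat) (r : labeling n) (o : 'I_n -> seq 'I_n).
Hypothesis rI : rank_inj r.
Hypothesis oA : acyclic o.
Hypothesis oU : forall x, uniq (o x).
Implicit Types (s : state n) (H : 'I_n -> seq (seq 'I_n)) (x y z a b w : 'I_n) (c k : nat).
Notation reach := (connect (arrow o)).
Notation tracks := (tracks r o).
Notation settled_arc := (settled_arc r).
Notation pending_arc := (pending_arc r).
Notation mass := (mass r o).

Definition settled s y := forall a b, reach y a -> b \in o a -> settled_arc s a b.

Definition call_post (calls : seq ('I_n * 'I_n)) y s s' H H' c :=
  [/\ exists N, forall fuel todo,
        update r (N + fuel) (calls ++ todo) s = charge c (update r fuel todo s'),
      tracks s' H',
      forall z, ~~ reach y z -> lab s' z = lab s z,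
      settled s' y
    & (forall a b, b \in o a -> settled_arc s a b -> settled_arc s' a b) /\
      (forall a b, b \in o a -> ~~ reach y a -> (a, b) \notin calls ->
        pending_arc s a b -> pending_arc s' a b)].

Lemma update1_tracks x y s H : y \in o x -> tracks s H -> pending_arc s x y ->
  (forall b, b \in o y -> settled_arc s y b) ->
  exists ch c s', [/\ update1 r x y s = charge c (ret (ch, s')) /\ c <= 5 + 2 * size (lab s x),
    forall z, z != y -> lab s' z = lab s z,
    settled_arc s' x y /\
      (forall a b, b \in o a -> a != y -> settled_arc s a b -> settled_arc s' a b),
    forall a b, b \in o a -> a != y -> (a, b) != (x, y) -> pending_arc s a b -> pending_arc s' a b
  & if ch then [/\ tracks s' (hist_add x y H), forall b, b \in o y -> pending_arc s' y b
          & mass H + size (o y) * (2 * (3 + size (lab s' y))) <= mass (hist_add x y H)]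
    else [/\ tracks s' H, lab s' = lab s, (rho r (lab s y) <= rho r (lab s x))%O
           & forall b, b \in o y -> settled_arc s' y b]].
Proof.
move=> xy trk sxy gy; have [os vH sH us hs] := trk.
have xny : x != y by apply: contraNneq (oA xy) => ->; apply: connect0.
rewrite /update1 (new_labelE oA xy trk).
have cmp := cmp_cost_l r (lab s x) (lab s y).
set l := extend r y (lab s x).
have sl : size l <= (size (lab s x)).+1 by apply: size_extend.
case: ltP => [lt|ge].
  have [le trk' tot] := tracks_lower rI oA xy trk lt.
  have lty : (rho r l < rho r (lab s y))%O by apply: le_lt_trans lt.
  have ln : l != lab s y by apply: contraTneq lty => ->; rewrite ltxx.
  rewrite (negbTE ln).
  set s' := State _ _ _.
  have ly : lab s' y = l by rewrite /= set_at_same.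
  have lo z : z != y -> lab s' z = lab s z by move=> zy; rewrite /= set_at_other.
  exists true, (1 + cmp_cost r (lab s x) (lab s y) + (1 + size l)), s'.
  split=> //.
  - by split; [rewrite charge_charge | lia].
  - split.
      split; first by rewrite ly lo.
      rewrite ly lo //= set_at_same eq_sym; case: eqP => //=; by rewrite mem_head.
    move=> a b ab ay [g1 g2].
    have [by_|by_] := eqVneq b y; last first.
      by split; rewrite !lo //= set_at_other.
    subst b; split; rewrite ly lo //; first by apply: le_trans g1; apply: ltW.
    rewrite /= set_at_same.
    (* A settled arc from [a] had a tail with label at least the old label of [y], so now the labels
       differ and [a] is rightly absent from the new list. *)
    have lta : (rho r l < rho r (lab s a))%O by apply: lt_le_trans lty g1.
    have -> : (lab s a == l) = false by apply/negbTE; apply: contraTneq lta => ->; rewrite ltxx.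
    case: eqP => // El; rewrite inE; apply/negbTE; apply: contraTneq lta => ->.
    by rewrite El ltxx.
  - move=> a b ab ay abxy sab.
    have [by_|by_] := eqVneq b y; last first.
      by rewrite /pending_arc !lo //= set_at_other.
    subst b; rewrite /pending_arc /= set_at_same; case: ifP => // _.
    by rewrite inE => /eqP E; rewrite E eqxx in abxy.
  - split.
    + apply: trk'; last by case: ifP.
      by move=> a; case: ifP => // _; rewrite inE => /eqP.
    (* Arcs out of [y] were settled, so [y] is listed at [b] only if their labels were equal; now
       that of [y] is strictly smaller. *)
    + move=> b yb; have by_ : b != y by apply: contraNneq (oA yb) => ->; apply: connect0.
      rewrite /pending_arc ly lo //= set_at_other // => ysb.
      have [_ g2] := gy _ yb; move: ysb; rewrite g2 => /eqP <-.
      exact: lty.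
    + by rewrite ly.
case: eqP => [E|/eqP nE].
  (* For a pending arc, being listed excludes equal labels; this keeps [same] free of duplicates. *)
  have xs : x \notin same s y.
    by apply/negP => /sxy; rewrite E ltxx.
  exists false, (1 + cmp_cost r (lab s x) (lab s y) + 1), (add_same x y s).
  split=> //.
  - by split; [rewrite charge_charge | lia].
  - split.
      by split; rewrite /= ?E // set_at_same mem_head eqxx.
    move=> a b ab ay [g1 g2]; split=> //=.
    have [by_|by_] := eqVneq b y; last by rewrite set_at_other.
    subst b; rewrite set_at_same inE; case: eqP => [->|_] //=.
    by rewrite E eqxx.
  - move=> a b ab ay abxy; rewrite /pending_arc /=.
    have [by_|by_] := eqVneq b y; last by rewrite set_at_other.
    subst b; rewrite set_at_same inE; case: eqP => //= ax.
    by rewrite ax eqxx in abxy.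
  - split=> //.
    + split=> //=.
        move=> z; have [->|zy] := eqVneq z y; last by rewrite set_at_other.
        by rewrite set_at_same /= xs us.
      move=> a b; have [->|zy] := eqVneq b y; last by rewrite set_at_other //; apply: hs.
      by rewrite set_at_same inE => /predU1P[->//|]; apply: hs.
    + move=> b yb; have by_ : b != y by apply: contraNneq (oA yb) => ->; apply: connect0.
      have [g1 g2] := gy _ yb; split=> //=; by rewrite set_at_other.
exists false, (1 + cmp_cost r (lab s x) (lab s y)), s; split=> //.
- by split; [|lia].
- split=> //; split=> //; rewrite (negbTE nE).
  by apply/negP => /sxy; rewrite ltNge ge.
Qed.

Lemma mass_hist_update k x y H : mass H <= mass (hist_update k o x y H).
Proof.
apply: leq_sum => z _; have [B ->] := hist_update_cat o k x y H z.
by rewrite weight_cat leq_mul2l leq_addr orbT.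
Qed.

(** The reachable set shrinks along every arc of a DAG, so [k] bounds the depth. Only the top call
    is charged to the caller; each call out of [y] is covered by the record that lowered [y]. *)
Lemma update_calls k x y s H : y \in o x -> #|Sset (arrow o) y| <= k -> tracks s H ->
  settled s y -> pending_arc s x y ->
  exists c s', call_post [:: (x, y)] y s s' H (hist_update k o x y H) c /\ settled_arc s' x y /\
    c + mass H <= 5 + 2 * size (lab s x) + mass (hist_update k o x y H).
Proof.
elim: k x y s H => [|k IH] x y s H xy Sk trk sy sxy.
  by move: Sk; rewrite leqNgt; case/negP; apply/card_gt0P; exists y; rewrite inE.
have gy b : b \in o y -> settled_arc s y b by apply: sy.
have [ch [c [s1 [[E1 c1] lo [g1 gg] ss]]]] := update1_tracks xy trk sxy gy.
have first_call fuel todo : update r (1 + fuel) ([:: (x, y)] ++ todo) s =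
    charge c (update r fuel ((if ch then [seq (y, w) | w <- o y] else [::]) ++ todo) s1).
  have [os _ _ _ _] := trk.
  by rewrite /= E1 bind_ret /= os.
have semi1 a b : b \in o a -> ~~ reach y a -> (a, b) \notin [:: (x, y)] ->
    pending_arc s a b -> pending_arc s1 a b.
  move=> ab ya; rewrite inE; apply: ss => //.
  by apply: contraNneq ya => ->.
(* If the label of [y] is unchanged the algorithm stops here, while the history still receives all
   paths below [y]. *)
case: ch first_call {E1} => first_call; last first.
  move=> [trk' labE le gy']; have [os vH sH us hs] := trk'.
  exists c, s1; split; last first.
    by split=> //; apply: leq_add c1 (mass_hist_update _ _ _ _).
  split=> //.
  - by exists 1 => fuel todo; rewrite first_call.
  - split=> //; first exact: valid_hist_update.
    apply: stored_hist_update => //; rewrite labE // => a b ya ab; by case: (sy a b ya ab).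
  - by move=> z _; rewrite labE.
  - move=> a b ya ab; have [E|ay] := eqVneq a y; first by subst a; apply: gy'.
    by apply: gg => //; apply: sy.
  - split=> // a b ab g; have [E|ay] := eqVneq a y; first by subst a; apply: gy'.
    exact: gg.
move=> [trk1 semi_y cost1].
(* Loop over the arcs out of [y]: those handled are settled, those in [ws] pending. The label of [y]
   is fixed meanwhile, because no out-neighbor reaches back to [y]. *)
have inner ws s2 H2 : uniq ws -> {subset ws <= o y} -> tracks s2 H2 ->
    (forall a b, reach y a -> a != y -> b \in o a -> settled_arc s2 a b) ->
    (forall w, w \in ws -> pending_arc s2 y w) ->
    (forall w, w \in o y -> w \notin ws -> settled_arc s2 y w) ->
    let H' := foldl (fun H' w => hist_update k o y w H') H2 ws in
    exists c' s', call_post [seq (y, w) | w <- ws] y s2 s' H2 H' c' /\ lab s' y = lab s2 y /\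
      c' + mass H2 <= size ws * (5 + 2 * size (lab s2 y)) + mass H'.
  elim: ws s2 H2 => [|w ws IHw] s2 H2 /= U sub trk2 gr sw gw.
    exists 0, s2; split; [split=> // | by []].
      by exists 0 => fuel todo; rewrite charge_zero.
    move=> a b ya ab; have [E|ay] := eqVneq a y; last exact: gr.
    by subst a; apply: gw.
  case/andP: U => wws U.
  have wy : w \in o y by apply: sub; rewrite mem_head.
  have ywR : reach y w by apply: connect1.
  have nwy : ~~ reach w y := oA wy.
  have Sw : #|Sset (arrow o) w| <= k.
    rewrite -ltnS; apply: leq_trans Sk; apply: proper_card; apply/properP; split.
      by apply/fintype.subsetP => z; rewrite !inE; apply: connect_trans.
    by exists y; rewrite inE ?connect0.
  have stw : settled s2 w.
    move=> a b wa ab; apply: gr => //; first exact: connect_trans wa.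
    by apply: contraNneq nwy => <-.
  have [c3 [s3 [[[N3 E3] trk3 lo3 st3 [gg3 ss3]] [g3 cost3]]]] :=
    IH y w s2 H2 wy Sw trk2 stw (sw _ (mem_head _ _)).
  have ly3 : lab s3 y = lab s2 y by apply: lo3.
  have sub' : {subset ws <= o y} by move=> z zs; apply: sub; rewrite inE zs orbT.
  have gr3 a b : reach y a -> a != y -> b \in o a -> settled_arc s3 a b.
    by move=> ya ay ab; apply: gg3 => //; apply: gr.
  have sw3 z : z \in ws -> pending_arc s3 y z.
    move=> zs; apply: ss3 => //; [exact: sub'| |by apply: sw; rewrite inE zs orbT].
    by rewrite inE xpair_eqE eqxx /=; apply: contraNneq wws => <-.
  have gw3 z : z \in o y -> z \notin ws -> settled_arc s3 y z.
    move=> zy zws; have [->//|zw] := eqVneq z w.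
    by apply: gg3 => //; apply: gw => //; rewrite inE negb_or zw.
  have [c4 [s4 [[[N4 E4] trk4 lo4 st4 [gg4 ss4]] [ly4 cost4]]]] :=
    IHw s3 (hist_update k o y w H2) U sub' trk3 gr3 sw3 gw3.
  exists (c3 + c4), s4; split; last first.
    split; first by rewrite ly4.
    by move: cost3 cost4; rewrite ly3 [(size ws).+1 * _]mulSn; lia.
  split=> //.
  - exists (N3 + N4) => fuel todo.
    have := E3 (N4 + fuel) ([seq (y, w0) | w0 <- ws] ++ todo).
    by rewrite /= addnA => ->; rewrite E4 charge_charge.
  - move=> z yz; rewrite lo4 // lo3 //; apply: contra yz; exact: connect_trans.
  - split=> a b ab.
      by move=> g; apply: gg4 => //; apply: gg3.
    move=> ya; rewrite inE negb_or => /andP[n1 n2] sab; apply: ss4 => //.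
    apply: ss3 => //; last by rewrite inE.
    apply: contra ya; exact: connect_trans.
have gr1 a b : reach y a -> a != y -> b \in o a -> settled_arc s1 a b.
  by move=> ya ay ab; apply: gg => //; apply: sy.
have gw1 w : w \in o y -> w \notin o y -> settled_arc s1 y w by move=> ->.
have [c2 [s2 [[[N2 E2] trk2 lo2 st2 [gg2 ss2]] [ly2 cost2]]]] :=
  inner (o y) s1 (hist_add x y H) (oU y) (fun=> id) trk1 gr1 semi_y gw1.
have notcall a b : ~~ reach y a -> (a, b) \notin [seq (y, w) | w <- o y].
  move=> ya; apply/mapP => -[w _ [E _]]; move: ya; by rewrite E connect0.
exists (c + c2), s2; split.
  split=> //.
  - exists (1 + N2) => fuel todo.
    by rewrite -addnA first_call E2 charge_charge.
  - move=> z yz; rewrite lo2 // lo //; by apply: contraNneq yz => ->.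
  - split=> a b ab.
      move=> g; have [E|ay] := eqVneq a y; last by apply: gg2 => //; apply: gg.
      by subst a; apply: st2.
    move=> ya nc sab; apply: ss2 => //; first exact: notcall.
    exact: semi1.
split; first by apply: gg2.
rewrite /=; move: cost2 cost1; set t := size (lab s1 y).
have : size (o y) * (5 + 2 * t) <= size (o y) * (2 * (3 + t)).
  by rewrite leq_mul2l; apply/orP; right; lia.
by move: c1; move: (size (o y) * (5 + _)) (size (o y) * (2 * _)) => A B; lia.
Qed.
End UpdateCalls.

(** * Searches *)

Section Stacks.
Variable n : nat.
Implicit Types (todo new : seq 'I_n) (seen : {set 'I_n}) (w x : 'I_n).

Lemma sum_remove (P1 P2 : pred 'I_n) (F : 'I_n -> nat) w :
  P1 w -> (forall x, P2 x -> P1 x && (x != w)) ->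
  F w + \sum_(x | P2 x) F x <= \sum_(x | P1 x) F x.
Proof.
move=> P1w sub; rewrite (bigD1 w P1w) /= leq_add2l.
rewrite [X in X <= _]big_mkcond [X in _ <= X]big_mkcond; apply: leq_sum => x _.
by case: ifP => // /sub->.
Qed.

Definition fresh seen (l : seq 'I_n) := [seq p <- l | p \notin seen].

(** A vertex is stacked only when first seen. The vertices stacked or unseen are thus the ones still
    to be handled, and [w] leaves them for good; the decreasing measure bounds the fuel. *)
Lemma push_fresh w todo seen l : uniq l -> uniq (w :: todo) -> {subset w :: todo <= seen} ->
  let new := fresh seen l in
  [/\ uniq (new ++ todo), {subset new ++ todo <= seen :|: [set:: new]},
    size (new ++ todo) + #|~: (seen :|: [set:: new])| < size (w :: todo) + #|~: seen|
  & forall x, (x \in new ++ todo) || (x \notin seen :|: [set:: new]) ->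
      ((x \in w :: todo) || (x \notin seen)) && (x != w)].
Proof.
rewrite cons_uniq => Ul /andP[label_cost Ut] sub new.
have Un : uniq new by apply: filter_uniq.
have newP x : x \in new -> x \notin seen by rewrite mem_filter => /andP[].
split.
- rewrite cat_uniq Un Ut andbT /=; apply/hasPn => x xt; apply/negP => /newP.
  by rewrite sub // inE xt orbT.
- by move=> x; rewrite mem_cat !inE => /orP[->|xt]; rewrite ?orbT // sub // inE xt orbT.
- have -> : #|~: seen| = size new + #|~: (seen :|: [set:: new])|.
    rewrite -(cardsID [set:: new] (~: seen)); congr (_ + _).
      rewrite -(card_uniqP Un); apply: eq_card => x; rewrite !inE.
      by case: (boolP (x \in new)) => [/newP->|]; rewrite ?andbF.
    by apply: eq_card => x; rewrite !inE negb_or andbC.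
  by rewrite size_cat /= addSn ltnS addnCA addnA addnAC.
- move=> x; rewrite mem_cat !inE negb_or -orbA => /or3P[/newP xs|xt|/andP[xs _]].
  + by rewrite xs orbT /=; apply: contraNneq xs => ->; rewrite sub // mem_head.
  + by rewrite xt orbT /=; apply: contraNneq label_cost => <-.
  + by rewrite xs orbT /=; apply: contraNneq xs => ->; rewrite sub // mem_head.
Qed.

End Stacks.

Section Searches.
Variables (n : nat) (r : labeling n) (s : state n).
Implicit Types (todo : seq 'I_n) (seen B C : {set 'I_n}) (u v w x : 'I_n).

Lemma bsearch_spec v C : (forall y, uniq (same s y)) ->
  (forall w, w \in C -> {subset same s w <= C}) ->
  forall m todo seen, size todo + #|~: seen| <= m -> uniq todo -> {subset todo <= seen} ->
  {subset seen <= C} ->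
  exists b seen' c, [/\ forall fuel, m <= fuel -> bsearch s v fuel todo seen = Some ((b, seen'), c),
    c <= \sum_(w | (w \in C) && ((w \in todo) || (w \notin seen))) (1 + 2 * size (same s w))
  & b = false -> {subset seen <= seen'} /\
      forall w, w \in seen' -> (w \in todo) || (w \notin seen) ->
        w != v /\ {subset same s w <= seen'}].
Proof.
move=> us CC; elim=> [|m IH] [|w todo] seen hm U sub sC.
- exists false, seen, 0; split=> [[|fuel]//|//|_].
  by split=> // w wseen; rewrite wseen.
- by [].
- exists false, seen, 0; split=> [[|fuel]//|//|_].
  by split=> // w wseen; rewrite wseen.
have wC : w \in C by apply: sC; apply: sub; rewrite mem_head.
have Pw : (w \in C) && ((w \in w :: todo) || (w \notin seen)) by rewrite wC mem_head.
have [wv|wv] := eqVneq w v.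
  exists true, seen, 1; split=> //.
    by move=> [//|fuel] _ /=; rewrite wv eqxx.
  by rewrite (bigD1 w Pw).
have [U2 sub2 lt2 rest] := push_fresh (us w) U sub.
have newC : {subset seen :|: [set:: fresh seen (same s w)] <= C}.
  by move=> x; rewrite !inE mem_filter => /orP[/sC//|/andP[_ /(CC _ wC)]].
have [b [seen' [c [E hc hb]]]] := IH _ _ (leq_trans lt2 hm) U2 sub2 newC.
exists b, seen', (1 + 2 * size (same s w) + c); split.
- by move=> [//|fuel] mf /=; rewrite (negbTE wv) -/(fresh _ _) E.
- apply: leq_trans (leq_add (leqnn _) hc) _; apply: sum_remove => // x /andP[xC].
  by move/rest => /andP[-> ->]; rewrite xC.
- move=> bf; have [s1 s2] := hb bf; split=> [x xs|x xs' hx].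
    by apply: s1; rewrite inE xs.
  have [->|xw] := eqVneq x w.
    split=> // z zs; apply: s1; rewrite !inE mem_filter zs andbT.
    by case: (z \in seen).
  apply: s2 => //; move: hx; rewrite inE (negbTE xw) /= mem_cat !inE.
  by case: (x \in todo); rewrite ?orbT //= => /negbTE ->; rewrite orbF orbN.
Qed.

Definition pop_cost u x := 1 + cmp_cost r (lab s u) (lab s x) +
  (if (rho r (lab s u) < rho r (lab s x))%O then 2 * size (out s x) else 0).

(** The parent clause allows a visited but unexpanded vertex to be charged to the expanded vertex
    that pushed it; the last clause is the closure from which completeness of the search follows. *)
Lemma fsearch_spec u B C : (forall y, uniq (out s y)) ->
  (forall w, w \in C -> {subset out s w <= C}) ->
  forall m todo seen, size todo + #|~: seen| <= m -> uniq todo -> {subset todo <= seen} ->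
  {subset seen <= C} ->
  exists b seen' c, [/\ forall fuel, m <= fuel -> fsearch r s u B fuel todo seen = Some (b, c),
    c <= \sum_(w | (w \in seen') && ((w \in todo) || (w \notin seen))) pop_cost u w,
    {subset seen <= seen'} /\ {subset seen' <= C},
    forall x, x \in seen' -> x \in seen \/
      exists w, [/\ w \in seen', (rho r (lab s u) < rho r (lab s w))%O & x \in out s w]
  & b = false -> forall w, w \in seen' -> (w \in todo) || (w \notin seen) ->
        w \notin B /\ ((rho r (lab s u) < rho r (lab s w))%O -> {subset out s w <= seen'})].
Proof.
move=> us CC; elim=> [|m IH] [|w todo] seen hm U sub sC.
- exists false, seen, 0; split=> [[|fuel]//|//||x xs|_]; [by split|by left|].
  by move=> w wseen; rewrite wseen.
- by [].
- exists false, seen, 0; split=> [[|fuel]//|//||x xs|_]; [by split|by left|].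
  by move=> w wseen; rewrite wseen.
have wseen : w \in seen by apply: sub; rewrite mem_head.
have wC : w \in C by apply: sC.
have [wB|wB] := boolP (w \in B).
  exists true, seen, 1; split=> //; [| |by split|by left].
    by move=> [//|fuel] _ /=; rewrite wB.
  by rewrite (bigD1 w) ?wseen ?mem_head.
have [lt|nlt] := boolP (rho r (lab s u) < rho r (lab s w))%O.
  have [U2 sub2 lt2 rest] := push_fresh (us w) U sub.
  have newC : {subset seen :|: [set:: fresh seen (out s w)] <= C}.
    by move=> x; rewrite !inE mem_filter => /orP[/sC//|/andP[_ /(CC _ wC)]].
  have [b [seen' [c [E hc [s1 s1'] par hb]]]] := IH _ _ (leq_trans lt2 hm) U2 sub2 newC.
  have s0 : {subset seen <= seen'} by move=> x xs; apply: s1; rewrite inE xs.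
  exists b, seen', (pop_cost u w + c); split=> //.
  - move=> [//|fuel] mf /=; rewrite (negbTE wB) lt -/(fresh _ _) E // /pop_cost lt /=.
    by rewrite addnA.
  - apply: leq_trans (leq_add (leqnn _) hc) _; apply: sum_remove.
      by rewrite s0 ?mem_head.
    by move=> x /andP[xC] /rest /andP[-> ->]; rewrite xC.
  - move=> x /par[|]; last by right.
    rewrite !inE mem_filter => /orP[|/andP[_ xw]]; first by left.
    by right; exists w; split=> //; apply: s0.
  - move=> bf x xs' hx; have [->|xw] := eqVneq x w.
      split=> // _ z zs; apply: s1; rewrite !inE mem_filter zs andbT.
      by case: (z \in seen).
    apply: (hb bf) => //; move: hx; rewrite inE (negbTE xw) /= mem_cat !inE.
    by case: (x \in todo); rewrite ?orbT //= => /negbTE ->; rewrite orbF orbN.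
have /andP[label_cost U2] : (w \notin todo) && uniq todo by [].
have sub2 : {subset todo <= seen} by move=> x xt; apply: sub; rewrite inE xt orbT.
have [b [seen' [c [E hc [s1 s1'] par hb]]]] := IH _ _ hm U2 sub2 sC.
exists b, seen', (pop_cost u w + c); split=> //.
- move=> [//|fuel] mf /=; rewrite (negbTE wB) (negbTE nlt) E // /pop_cost (negbTE nlt) /=.
  by rewrite addn0.
- apply: leq_trans (leq_add (leqnn _) hc) _; apply: sum_remove.
    by rewrite s1 ?mem_head.
  move=> x /andP[-> /orP[xt|xs]] /=.
    by rewrite inE xt orbT /=; apply: contraNneq label_cost => <-.
  by rewrite xs orbT /=; apply: contraNneq xs => ->.
- move=> bf x xs' hx; have [->|xw] := eqVneq x w.
    by split=> //; rewrite (negbTE nlt).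
  by apply: (hb bf) => //; move: hx; rewrite inE (negbTE xw).
Qed.

End Searches.

(** * States between insertions *)

Section Consistent.
Variables (n : nat) (r : labeling n).
Hypothesis rI : rank_inj r.
Implicit Types (s : state n) (H : 'I_n -> seq (seq 'I_n)) (x y z a b w u v : 'I_n).
Implicit Types (o : 'I_n -> seq 'I_n).

Definition consistent o s H := tracks r o s H /\ forall a b, b \in o a -> settled_arc r s a b.

Lemma lab_inj o s H x y : tracks r o s H ->
  rho r (lab s x) = rho r (lab s y) -> lab s x = lab s y.
Proof.
by move=> [_ _ sH _ _]; apply: rho_inj => //; apply: stored_rankeds sH.
Qed.

Section Fixed.
Variables (o : 'I_n -> seq 'I_n) (s : state n) (H : 'I_n -> seq (seq 'I_n)).
Hypothesis con : consistent o s H.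
Notation reach := (connect (arrow o)).

Lemma rho_reach x y : reach x y -> (rho r (lab s y) <= rho r (lab s x))%O.
Proof.
case/connectP => p; elim: p x => [|z p IH] x /=; first by move=> _ ->.
move=> /andP[xz /IH h] /h le; apply: le_trans le _.
by have [] := con.2 _ _ xz.
Qed.

(** Along settled arcs minimality propagates from the history to all paths of the current graph. *)
Lemma rho_path p x : sorted (arrow o) (rcons p x) ->
  (rho r (lab s x) <= rho r (path_label r (rcons p x)))%O.
Proof.
have [[_ vH sH _ _] g] := con.
elim/last_ind: p x => [|p y IH] x.
  move=> _; have [l0 l0r E] := stored_extend x vH sH; rewrite E.
  rewrite (path_label_rcons r [::]) /=; apply: (extend_le_extend (l := [::])) => //.
  by apply: rho_le_nil; rewrite -E; apply: stored_rankeds sH.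
move=> sp; have [l0 l0r E] := stored_extend x vH sH.
rewrite path_label_rcons E; apply: extend_le_extend => //.
  exact: rankeds_path_label.
rewrite -E; have spy : sorted (arrow o) (rcons p y).
  by move: sp; rewrite -cats1 => /cat_sorted2[].
apply: le_trans (IH _ spy).
have yx : x \in o y.
  by move: sp; rewrite -!cats1 -catA sorted_cat_cons => /andP[_] /=; rewrite andbT.
by have [] := g _ _ yx.
Qed.

(** Labels are monotone along arcs, so equal labels at both ends of a path force equal labels
    throughout, and every arc of the path is then in a list [same]. *)
Lemma reach_same_label (B : {set 'I_n}) u : u \in B ->
  (forall w, w \in B -> {subset same s w <= B}) ->
  forall w, reach w u -> lab s w = lab s u -> w \in B.
Proof.
move=> uB BB w /connectP[p]; elim: p w => [|z p IH] w /=; first by move=> _ <-.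
move=> /andP[wz pz] E Ew.
have zu : reach z u by apply/connectP; exists p.
have Ez : lab s z = lab s w.
  apply: (lab_inj con.1); apply/eqP; rewrite eq_le; have [-> _] := con.2 _ _ wz.
  by rewrite Ew rho_reach.
apply: (BB z); first by apply: IH => //; rewrite Ez.
by have [_ ->] := con.2 _ _ wz; rewrite Ez.
Qed.

(** The label of [u] is already attained by a path to [x], so monotonicity squeezes the labels of
    [x], [t] and [u] together. But the label of a ranked vertex ends with that vertex, whence
    [t = x]. *)
Lemma ranked_rho t u x q : t \in ranked r -> reach x t -> t != x -> x \in ranked r ->
  reach t u -> lab s u = rcons q x -> False.
Proof.
move=> tr xt tx xr tu E.
have [[_ vH sH _ _] g] := con.
have [[p pH pE] _] := sH u; rewrite -pE in E.
have [p1 [p2 [Ep E1]]] := last_path_label E.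
have [q' Eq sp] := vH _ _ pH; rewrite Ep in sp.
have le1 := rho_path (cat_sorted2 sp).1; rewrite E1 -E pE in le1.
have le2 := rho_reach xt; have le3 := rho_reach tu.
have Ext : lab s t = lab s x.
  apply: (lab_inj con.1); apply/eqP; rewrite eq_le le2 /=.
  exact: le_trans le1 le3.
have lastE y : y \in ranked r -> exists q, lab s y = rcons q y.
  move=> yr; have [l0 _ ->] := stored_extend y vH sH.
  by have [q0 -> _] := extend_ranked l0 yr; exists q0.
have [q1 Et] := lastE _ tr; have [q2 Ex] := lastE _ xr.
move: Ext; rewrite Et Ex => /rcons_inj[_ txE].
by rewrite txE eqxx in tx.
Qed.

Definition label_class u := finset (fun w => reach w u && (lab s w == lab s u)).

(** An empty label has no last entry; in that case nothing above [u] is ranked at all. *)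
Lemma label_class_gap u :
  label_class u \subset Pset (arrow o) u /\ [disjoint Pset (arrow o) u & ranked r] \/
  exists x, label_class u \subset Dset (arrow o) x u /\
    [disjoint Dset (arrow o) x u :\ x & ranked r].
Proof.
have [[_ vH sH _ _] g] := con.
case E : (lab s u) / (lastP (lab s u)) => [|q x].
  left; split.
    by apply/fintype.subsetP => w; rewrite !inE => /andP[].
  rewrite disjoint_subset; apply/fintype.subsetP => t; rewrite inE => tu.
  apply/negP => tr; have := rho_reach tu; rewrite E.
  have := stored_rankeds (y := t) sH; have [l0 _ ->] := stored_extend t vH sH.
  have [[|z q] -> _] := extend_ranked l0 tr; rewrite /= ?rcons_cons;
    by move=> /rankeds_cons[zr _]; rewrite rho_nil_le.
right; exists x; have xr : x \in ranked r.
  by apply: (stored_rankeds (y := u) sH); rewrite E mem_rcons mem_head.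
split.
  apply/fintype.subsetP => w; rewrite !inE => /andP[wu /eqP Ew]; rewrite wu andbT.
  by apply: (stored_reach vH sH); rewrite Ew E mem_rcons mem_head.
rewrite disjoint_subset; apply/fintype.subsetP => t tD; rewrite inE; apply/negP => tr.
move: tD; rewrite in_setD1 inE => /andP[tx]; rewrite !inE => /andP[xt tu].
exact: (ranked_rho tr xt tx xr tu E).
Qed.

(** The class itself depends on the ranking. This bound depends on it only through [L]: it is
    [t ^ 2] unless one of the [n + 1] sets that can contain the class is large and unranked, where
    the trivial [n ^ 2] is paid. The sum runs over all [x] since the last entry is not known in
    advance. *)
Definition search_bound o u (L : {set 'I_n}) t := t ^ 2
  + n ^ 2 * \sum_x (t < #|Dset (arrow o) x u|) && [disjoint Dset (arrow o) x u :\ x & L]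
  + n ^ 2 * ((t < #|Pset (arrow o) u|) && [disjoint Pset (arrow o) u & L]).

Lemma label_class_bound u t : #|label_class u| ^ 2 <= search_bound o u (ranked r) t.
Proof.
have [le|lt] := leqP #|label_class u| t.
  by rewrite /search_bound -addnA (leq_trans _ (leq_addr _ _)) // leq_exp2r.
have cn : #|label_class u| ^ 2 <= n ^ 2.
  by rewrite leq_exp2r // -[n in _ <= n]card_ord max_card.
case: (label_class_gap u) => [[sub dis]|[x [sub dis]]].
  rewrite /search_bound dis (leq_trans lt (subset_leq_card sub)) /= muln1.
  exact: leq_trans cn (leq_addl _ _).
rewrite /search_bound (bigD1 x) //= dis (leq_trans lt (subset_leq_card sub)) /=.
rewrite mulnDr muln1; apply: leq_trans cn _.
by rewrite -addnA -addnA addnCA leq_addr.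
Qed.

End Fixed.

Lemma acyclic_add o u v : acyclic o -> ~~ connect (arrow o) v u ->
  acyclic (set_at o u (v :: o u)).
Proof.
move=> oA vu; set o' := set_at _ _ _.
have arrow' a b : b \in o' a -> b \in o a \/ a = u /\ b = v.
  rewrite /o' /set_at; case: eqP => [->|_]; last by left.
  by rewrite inE => /predU1P[->|]; [right|left].
have conn' a b : connect (arrow o') a b ->
    connect (arrow o) a b \/ connect (arrow o) a u /\ connect (arrow o) v b.
  case/connectP => p; elim: p a => [|z p IH] a /=; first by move=> _ ->; left.
  move=> /andP[/arrow'[az|[-> ->]] /IH h] /h[zb|[zu vb]].
  - by left; apply: connect_trans zb; apply: connect1.
  - by right; split=> //; apply: connect_trans zu; apply: connect1.
  - by right.
  - by right.
move=> x y /arrow'[xy|[-> ->]]; apply/negP => /conn'[yx|[yu vx]].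
- by move: (oA _ _ xy); rewrite yx.
- case/negP: vu; apply: connect_trans vx _; apply: connect_trans yu; exact: connect1.
- by rewrite yx in vu.
- by rewrite yu in vu.
Qed.

Lemma valid_add o u v H : valid o H -> valid (set_at o u (v :: o u)) H.
Proof.
move=> vH y p /vH[q E sp]; exists q => //; apply: sub_sorted sp => a b.
by rewrite /arrow /set_at; case: eqP => // ->; rewrite inE => ->; rewrite orbT.
Qed.

(** In lexicographic order, a common prefix of two bounds is a prefix of everything between them. *)
Lemma lcp_between (a b c : seqlexi nat) : (a <= b)%O -> (b <= c)%O ->
  size (lcp (c : seq nat) (a : seq nat)) <= size (b : seq nat).
Proof.
elim: a b c => [|x a IH] [|y b] [|z c] //=; try by rewrite lcpC.
rewrite !(Order.SeqLexiOrder.Exports.lexi_cons) !leEnat => /andP[xy h1] /andP[yz h2].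
case: eqP => //= zx; rewrite ltnS; apply: IH.
  by apply: (implyP h1); rewrite -zx.
by apply: (implyP h2); rewrite zx.
Qed.


Definition label_cost (l : seq 'I_n) := 3 + size l.
Definition hweight (H : 'I_n -> seq (seq 'I_n)) x := weight r 3 [::] (H x).

(** A minimum over a longer list cannot go up, so a changed label has strictly decreased and the
    added paths contain a record attaining it. *)
Lemma hweight_grow lb lb' H H' x B : stored r lb H -> stored r lb' H' -> H' x = H x ++ B ->
  lb' x != lb x -> hweight H x + label_cost (lb' x) <= hweight H' x.
Proof.
move=> sH sH' E ne; have [[p pH pE] mn] := sH x; have [[p' pH' pE'] mn'] := sH' x.
have le : (rho r (lb' x) <= rho r (lb x))%O.
  by rewrite -pE; apply: mn'; rewrite E mem_cat pH.
have lt : (rho r (lb' x) < rho r (lb x))%O.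
  rewrite lt_neqAle le andbT; apply: contraNneq ne => /rho_inj -> //.
    exact: stored_rankeds sH'.
  exact: stored_rankeds sH.
have old q : q \in H x -> (rho r (lb' x) < rho r (path_label r q))%O.
  by move=> /mn; apply: lt_le_trans.
rewrite /hweight E weight_cat leq_add2l; apply: weight_new => //.
- exists p' => //; move: pH'; rewrite E mem_cat => /orP[/old|//].
  by rewrite pE' ltxx.
- by move=> q qB; apply: mn'; rewrite E mem_cat qB orbT.
- by move=> q; rewrite catrevE cats0 mem_rev; apply: old.
Qed.

Lemma hweight_min lb H x : stored r lb H -> label_cost (lb x) <= hweight H x.
Proof.
by move=> sH; have [hp mn] := sH x; apply: weight_new.
Qed.

Section Insert.
Variables (o : 'I_n -> seq 'I_n) (s : state n) (H : 'I_n -> seq (seq 'I_n)) (u v : 'I_n).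
Hypotheses (con : consistent o s H) (oA : acyclic o) (oU : forall x, uniq (o x)).
Hypothesis uv : v \notin o u.
Let o' := set_at o u (v :: o u).
(** Weights fixed for the whole run: they dominate the out-degrees, and they are positive at heads
    of arcs so that a vertex reached by the search can pay for its own visit. *)
Variable d : 'I_n -> nat.
Hypotheses (dsize : forall x, size (o' x) <= d x) (dpos : forall a b, b \in o' a -> 0 < d b).

Lemma arrow_add a b : b \in o' a -> b \in o a \/ a = u /\ b = v.
Proof.
rewrite /o' /set_at; case: eqP => [->|_]; last by left.
by rewrite inE => /predU1P[->|]; [right|left].
Qed.

Lemma sub_add a b : b \in o a -> b \in o' a.
Proof. by rewrite /o' /set_at; case: eqP => // ->; rewrite inE => ->; rewrite orbT. Qed.

Lemma mem_add : v \in o' u.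
Proof. by rewrite /o' set_at_same mem_head. Qed.

Lemma uniq_add x : uniq (o' x).
Proof. by rewrite /o' /set_at; case: eqP => _ /=; rewrite ?uv oU. Qed.

Lemma consistent_noop sm : ~~ connect (arrow o) v u ->
  (rho r (lab s v) <= rho r (lab s u))%O ->
  (forall y, uniq (sm y)) -> (forall a b, a \in sm b -> b \in o' a) ->
  (forall a b, b \in o' a -> (a \in sm b) = (lab s a == lab s b)) ->
  consistent o' (State o' sm (lab s)) (hist_update n o' u v H).
Proof.
move=> vu le us sub sg; have [[os vH sH _ _] g] := con.
have vH' := valid_add u v vH.
have gr a b : b \in o' a -> (rho r (lab s b) <= rho r (lab s a))%O.
  by move=> /arrow_add[/g[]//|[-> ->]].
split; last by move=> a b ab; split; [apply: gr|apply: sg].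
split=> //; first by apply: valid_hist_update => //; apply: mem_add.
by apply: stored_hist_update => //; [apply: mem_add|move=> a b _; apply: gr].
Qed.

(* A popped vertex whose label changes pays with its old label, which it leaves for good;
   the others pay with the new label of the expanded in-neighbor they were reached from. *)
Lemma fsearch_cost s' H' (X : {set 'I_n}) : consistent o' s' H' ->
  (forall x, exists B, H' x = H x ++ B) -> lab s' u = lab s u ->
  (forall x, ~~ connect (arrow o') v x -> lab s' x = lab s x) ->
  (rho r (lab s u) < rho r (lab s v))%O ->
  (forall x, x \in X -> x = v \/
     exists w, [/\ w \in X, (rho r (lab s u) < rho r (lab s w))%O & x \in o w]) ->
  (forall x, x \in X -> connect (arrow o') v x) ->
  \sum_(x in X) pop_cost r s u x + \sum_x 2 * d x * label_cost (lab s' x)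
    + \sum_x 4 * d x * hweight H x
    <= \sum_x 2 * d x * label_cost (lab s x) + \sum_x 4 * d x * hweight H' x.
Proof.
move=> con' HB lu lo ltuv Xpar Xr.
have [[os vH sH _ _] g] := con; have [[os' vH' sH' _ _] g'] := con'.
(* An expanded vertex started above [u], but after the update it lies below the settled arc into
   [v], hence has a label at most that of [u]. *)
have changed w : connect (arrow o') v w -> (rho r (lab s u) < rho r (lab s w))%O ->
    (rho r (lab s' w) <= rho r (lab s u))%O /\ lab s' w != lab s w.
  move=> vw lt; have le : (rho r (lab s' w) <= rho r (lab s u))%O.
    rewrite -lu; apply: le_trans (rho_reach con' vw) _.
    by have [] := g' _ _ mem_add.
  by split=> //; apply: contraTneq lt => <-; rewrite -leNgt.
pose ch x := lab s' x != lab s x.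
have dch x : ch x -> 0 < d x.
  move=> cx; have : connect (arrow o') v x by apply: contraNT (cx : lab s' x != lab s x) => /lo/eqP.
  case/connectP => p; case/lastP: p => [|p y] /=; first by move=> _ ->; apply: dpos mem_add.
  by rewrite rcons_path last_rcons => /andP[_ yx] ->; apply: dpos yx.
have h1 : \sum_(x in X) pop_cost r s u x <=
    \sum_(x | ch x) (label_cost (lab s x) + 2 * (size (o x) * label_cost (lab s' x))).
  have part1 : \sum_(x in X | ch x) pop_cost r s u x <=
      \sum_(x | ch x) (label_cost (lab s x) + size (o x) * label_cost (lab s' x)).
    rewrite big_mkcond [X in _ <= X]big_mkcond; apply: leq_sum => x _.
    case: (x \in X); case: (ch x) => //=.
    have := cmp_cost_r r (lab s u) (lab s x); rewrite /pop_cost /label_cost os => hc.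
    apply: leq_add; first by lia.
    by case: ifP => // _; rewrite mulnC leq_mul2l; apply/orP; right; lia.
  (* An unchanged vertex was neither expanded nor equal to [v]; it is charged to an expanded
     in-neighbor [w], which receives at most [size (o w)] such charges. *)
  have part2 : \sum_(x in X | ~~ ch x) pop_cost r s u x <=
      \sum_(w | ch w) size (o w) * label_cost (lab s' w).
    have : forall x, (x \in X) && ~~ ch x ->
        pop_cost r s u x <= \sum_(w | ch w && (x \in o w)) label_cost (lab s' w).
      move=> x /andP[xX nch].
      have nexp : (rho r (lab s u) < rho r (lab s x))%O = false.
        by apply/negbTE; apply: contra nch => lt; have [_ ] := changed x (Xr x xX) lt.
      case: (Xpar x xX) => [xv|[w [wX lt xw]]]; first by rewrite xv ltuv in nexp.
      have [le cw] := changed w (Xr w wX) lt.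
      rewrite (bigD1 w) /=; last by rewrite /ch cw xw.
      apply: leq_trans (leq_addr _ _); rewrite /pop_cost nexp addn0 /cmp_cost /label_cost.
      have xE : lab s' x = lab s x by apply/eqP; rewrite -[_ == _]negbK.
      (* The new label of [w] lies between those of [x] and [u], so the comparison reads little more
         than its length. *)
      have := @lcp_between (rho r (lab s x)) (rho r (lab s' w)) (rho r (lab s u)).
      rewrite le -xE; have [-> _] := g' _ _ (sub_add xw) => /(_ isT isT).
      by rewrite size_rho; lia.
    move=> hx; apply: leq_trans (leq_sum _ hx) _.
    rewrite (exchange_big_dep ch) /=; last by move=> x w _ /andP[].
    apply: leq_sum => w cw; rewrite sum_nat_const leq_mul2r; apply/orP; right.
    rewrite -(card_uniqP (oU w)); apply: subset_leq_card; apply/fintype.subsetP => x.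
    by case/andP => _ /andP[].
  rewrite (bigID ch) /=; apply: leq_trans (leq_add part1 part2) _.
  by rewrite -big_split /=; apply: leq_sum => x _; lia.
rewrite -addnA; apply: leq_trans (leq_add h1 (leqnn _)) _.
rewrite big_mkcond -!big_split /=; apply: leq_sum => x _.
have [B EB] := HB x.
have so : size (o x) <= d x.
  apply: leq_trans (dsize x); rewrite /o' /set_at; case: eqP => // -> /=.
  exact: leqnSn.
case: ifP => cx; last first.
  have -> : lab s' x = lab s x by apply/eqP; apply: negbFE.
  rewrite add0n leq_add2l leq_mul2l; apply/orP; right.
  by rewrite /hweight EB weight_cat leq_addr.
have gw := hweight_grow sH sH' EB cx; have d0 := dch _ cx.
have e1 : size (o x) * label_cost (lab s' x) <= d x * label_cost (lab s' x).
  by rewrite leq_mul2r so orbT.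
have e2 : label_cost (lab s x) <= d x * label_cost (lab s x) by rewrite leq_pmull.
have e3 : d x * (hweight H x + label_cost (lab s' x)) <= d x * hweight H' x.
  by rewrite leq_mul2l gw orbT.
move: e1 e2 e3; rewrite mulnDr -!mulnA; lia.
Qed.

End Insert.
End Consistent.

(** * Insertions *)

Section InsertSpec.
Variables (n : nat) (r : labeling n).
Hypothesis rI : rank_inj r.
Implicit Types (s : state n) (H : 'I_n -> seq (seq 'I_n)) (x y z a b w u v : 'I_n).
Implicit Types (o : 'I_n -> seq 'I_n).

Variables (o : 'I_n -> seq 'I_n) (s : state n) (H : 'I_n -> seq (seq 'I_n)) (u v : 'I_n).
Hypotheses (con : consistent r o s H) (oA : acyclic o) (oU : forall x, uniq (o x)).
Hypothesis uv : v \notin o u.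
Let o' := set_at o u (v :: o u).
Variable d : 'I_n -> nat.
Hypotheses (dsize : forall x, size (o' x) <= d x) (dpos : forall a b, b \in o' a -> 0 < d b).

Lemma bsearch_class : exists N (b : bool) B c,
  [/\ forall fuel, N <= fuel -> bsearch s v fuel [:: u] [set u] = Some ((b, B), c),
    c <= 3 * #|label_class o s u| ^ 2
  & b = false -> u \in B /\ forall w, w \in B -> w != v /\ {subset same s w <= B}].
Proof.
have [[os vH sH us hs] g] := con.
set C := label_class o s u.
have CC w : w \in C -> {subset same s w <= C}.
  rewrite inE => /andP[wu /eqP Ew] z zw; have wz := hs _ _ zw.
  have [_ g2] := g _ _ wz; rewrite inE (connect_trans (connect1 wz) wu) /=.
  by rewrite -Ew -g2.
have uC : u \in C by rewrite inE connect0 eqxx.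
have sub1 : {subset [:: u] <= [set u]} by move=> x; rewrite !inE.
have sub2 : {subset [set u] <= C} by move=> x; rewrite inE => /eqP->.
have [b [B [c [E hc hb]]]] := bsearch_spec v us CC (leqnn _) (isT : uniq [:: u]) sub1 sub2.
exists (size [:: u] + #|~: [set u]|), b, B, c; split=> //.
  apply: leq_trans hc _.
  apply: (@leq_trans (\sum_(w in C) 3 * #|C|)); last first.
    by rewrite sum_nat_const mulnCA.
  rewrite big_mkcond [X in _ <= X]big_mkcond; apply: leq_sum => w _.
  case: (boolP (w \in C)) => wC //=; case: ifP => // _.
  have : size (same s w) <= #|C|.
    rewrite -(card_uniqP (us w)); apply: subset_leq_card; apply/fintype.subsetP.
    exact: CC.
  have : 0 < #|C| by apply/card_gt0P; exists w.
  by move=> h1 h2; rewrite [3 * _]mulSn leq_add // leq_mul2l h2 orbT.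
move=> bf; have [h1 h2] := hb bf; split; first by apply: h1; rewrite inE.
by move=> w wB; apply: h2 => //; rewrite !inE orbN.
Qed.

(** On a path from [v] to [u] the labels decrease towards that of [u]. While they are strictly above
    it the forward search expands; at the first equality the vertex is in [B], where the search
    would have reported a cycle. *)
Lemma search_complete (B X : {set 'I_n}) : u \in B ->
  (forall w, w \in B -> {subset same s w <= B}) ->
  v \in X -> (forall w, w \in X -> w \notin B /\
     ((rho r (lab s u) < rho r (lab s w))%O -> {subset o w <= X})) ->
  ~~ connect (arrow o) v u.
Proof.
move=> uB BB vX hX; apply/negP => /connectP[p].
elim: p v vX => [|z p IH] w wX /=.
  by move=> _ E; have [] := hX w wX; rewrite -E uB.
move=> /andP[wz pz] E; have [wB hw] := hX w wX.
have wu : connect (arrow o) w u by apply/connectP; exists (z :: p) => //=; rewrite wz.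
have le := rho_reach con wu; move: le; rewrite le_eqVlt => /predU1P[Er|lt].
  by case/negP: wB; apply: (reach_same_label rI con uB BB wu); apply: (lab_inj rI con.1).
by apply: IH pz E; apply: hw.
Qed.

Lemma tracks_add : tracks r o' (add_arc u v s) H.
Proof.
have [[os vH sH us hs] g] := con; split=> //=; first by rewrite os.
  exact: valid_add.
by move=> a b /hs; apply: sub_add.
Qed.

Lemma update_insert : ~~ connect (arrow o) v u -> (rho r (lab s u) < rho r (lab s v))%O ->
  exists N c s', [/\ forall fuel, N <= fuel ->
      update r fuel [:: (u, v)] (add_arc u v s) = Some (s', c),
    consistent r o' s' (hist_update n o' u v H),
    lab s' u = lab s u,
    forall x, ~~ connect (arrow o') v x -> lab s' x = lab s x
  & c + mass r o' H <= 5 + 2 * size (lab s u) + mass r o' (hist_update n o' u v H)].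
Proof.
move=> vu lt; have [[os vH sH us hs] g] := con.
have oA' : acyclic o' := acyclic_add oA vu.
have vin : v \in o' u := mem_add o u v.
have g' a b : b \in o' a -> (a, b) != (u, v) -> settled_arc r (add_arc u v s) a b.
  by move=> /arrow_add[/g//|[-> ->]]; rewrite eqxx.
have st : settled r o' (add_arc u v s) v.
  move=> a b va ab; apply: g' => //; apply: contraTneq va => -[-> _].
  exact: oA'.
have sm : pending_arc r (add_arc u v s) u v by move=> /hs; rewrite (negbTE uv).
have Sn : #|Sset (arrow o') v| <= n by rewrite -[n in _ <= n]card_ord max_card.
have [c [s' [[[N E] trk lo st' [gg _]] [guv cost]]]] :=
  update_calls rI oA' (uniq_add oU uv) vin Sn tracks_add st sm.
exists N, c, s'; split=> //.
- move=> fuel Nf; have := E (fuel - N) [::]; rewrite subnKC //= => ->.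
  by case: (fuel - N) => [|?] /=; rewrite addn0.
- split=> // a b ab; have [[-> ->]//|ne] := eqVneq (a, b) (u, v).
  by apply: gg => //; apply: g'.
- by rewrite lo //; apply: oA'.
Qed.

Let H' := hist_update n o' u v H.

(** Of the factor 6, a share 4 pays the forward search and 2 the update. The sums of [label_cost]
    are the part of the potential held by current labels. On a cycle report that part pays the
    forward search directly. *)
Lemma insert_spec : exists N res c,
  (forall fuel, N <= fuel -> insert r fuel u v s = Some (res, c)) /\
  if res is Some s' then
    [/\ ~~ connect (arrow o) v u, consistent r o' s' H'
      & c + \sum_x 6 * d x * hweight r H x + \sum_x 2 * d x * label_cost (lab s' x) <=
        4 * label_cost (lab s u) + 3 * #|label_class o s u| ^ 2
        + \sum_x 6 * d x * hweight r H' x + \sum_x 2 * d x * label_cost (lab s x)]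
  else c <= 4 * label_cost (lab s u) + 3 * #|label_class o s u| ^ 2
            + \sum_x 2 * d x * label_cost (lab s x).
Proof.
have [[os vH sH us hs] g] := con.
have cmp := cmp_cost_l r (lab s u) (lab s v).
have HB x : exists B, H' x = H x ++ B := hist_update_cat o' n u v H x.
have Hle : \sum_x 6 * d x * hweight r H x <= \sum_x 6 * d x * hweight r H' x.
  apply: leq_sum => x _; have [B EB] := HB x.
  by rewrite leq_mul2l /hweight EB weight_cat leq_addr orbT.
have us_v : u \notin same s v by apply: contra uv => /hs.
have [ltvu|] := boolP (rho r (lab s v) < rho r (lab s u))%O.
  have vu : ~~ connect (arrow o) v u.
    by apply/negP => /(rho_reach con); rewrite leNgt ltvu.
  exists 0, (Some (add_arc u v s)), (1 + cmp_cost r (lab s u) (lab s v)); split.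
    by move=> fuel _; rewrite /insert ltvu /= addn0.
  split=> //; last by move: Hle; rewrite /label_cost /=; lia.
  rewrite /add_arc os; apply: consistent_noop => //.
  - exact: ltW.
  - by move=> a b /hs; apply: sub_add.
  - move=> a b /arrow_add[/g[]//|[-> ->]].
    rewrite (negbTE us_v); apply/esym/negbTE; apply: contraTneq ltvu => ->.
    by rewrite ltxx.
rewrite -leNgt => leuv.
have [N1 [b [B [c1 [E1 hc1 hb]]]]] := bsearch_class.
case: b E1 hb => E1 hb.
  exists N1, None, (1 + cmp_cost r (lab s u) (lab s v) + c1).
  split; last by rewrite /label_cost; lia.
  by move=> fuel Nf; rewrite /insert ltNge leuv /= E1 //= addn0.
have [uB hB] := hb erefl.
have BB w : w \in B -> {subset same s w <= B} by move=> /hB[].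
have [ltuv|] := boolP (rho r (lab s u) < rho r (lab s v))%O; last first.
  rewrite -leNgt => levu.
  have Euv : lab s u = lab s v.
    by apply: (lab_inj rI con.1); apply/eqP; rewrite eq_le leuv levu.
  have vu : ~~ connect (arrow o) v u.
    apply/negP => vu; have vB := reach_same_label rI con uB BB vu (esym Euv).
    by have [] := hB _ vB; rewrite eqxx.
  exists N1, (Some (add_same u v (add_arc u v s))),
    (1 + cmp_cost r (lab s u) (lab s v) + (c1 + 1)); split.
    by move=> fuel Nf; rewrite /insert ltNge leuv /= E1 //= Euv ltxx /= addn0.
  split=> //; last by move: Hle hc1; rewrite /label_cost /=; lia.
  rewrite /add_same /add_arc os /=; apply: consistent_noop => //.
  - move=> y; have [->|yv] := eqVneq y v; last by rewrite set_at_other.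
    by rewrite set_at_same /= us_v us.
  - move=> a b; have [->|bv] := eqVneq b v; last first.
      by rewrite set_at_other // => /hs; apply: sub_add.
    rewrite set_at_same inE => /predU1P[->|/hs]; first exact: mem_add.
    exact: sub_add.
  - move=> a b /arrow_add[ab|[-> ->]]; last by rewrite set_at_same mem_head Euv eqxx.
    have [_ <-] := g _ _ ab; have [bv|bv] := eqVneq b v; last by rewrite set_at_other.
    rewrite bv set_at_same inE; case: eqP => //= au.
    by move: uv; rewrite -au -bv ab.
pose C := Sset (arrow o) v.
have CC w : w \in C -> {subset out s w <= C}.
  by rewrite inE os => vw z wz; rewrite inE; apply: connect_trans vw (connect1 _).
have sub1 : {subset [:: v] <= [set v]} by move=> x; rewrite !inE.
have sub2 : {subset [set v] <= C} by move=> x; rewrite !inE => /eqP->.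
have osU x : uniq (out s x) by rewrite os.
have [b [X [c2 [E2 hc2 [vX XC] Xpar hX]]]] :=
  fsearch_spec r u B osU CC (leqnn _) (isT : uniq [:: v]) sub1 sub2.
set N2 := size _ + _ in E2.
have sumX : c2 <= \sum_(x in X) pop_cost r s u x.
  apply: leq_trans hc2 _; rewrite big_mkcond [X in _ <= X]big_mkcond.
  by apply: leq_sum => x _; case: (x \in X) => //=; case: ifP.
have insertE fuel res c : N1 <= fuel ->
    (let! c := fsearch r s u B fuel [:: v] [set v] in
       if c then ret None else
       let! t := update r fuel [:: (u, v)] (add_arc u v s) in ret (Some t)) = Some (res, c) ->
    insert r fuel u v s = Some (res, 1 + cmp_cost r (lab s u) (lab s v) + (c1 + c)).
  by move=> Nf h; rewrite /insert ltNge leuv /= E1 // /= ltuv h.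
case: b E2 hX => E2 hX.
  exists (maxn N1 N2), None, (1 + cmp_cost r (lab s u) (lab s v) + (c1 + (c2 + 0))); split.
    move=> fuel; rewrite geq_max => /andP[Nf1 Nf2].
    by apply: insertE; rewrite ?E2.
  (* No update follows a report, so every visited vertex pays with its current label; [d x >= 1]
     makes [2 * d x * label_cost] sufficient. *)
  have hf : \sum_(x in X) pop_cost r s u x <= \sum_x 2 * d x * label_cost (lab s x).
    rewrite big_mkcond; apply: leq_sum => x _; case: ifP => // xX.
    have dx : 0 < d x.
      case: (Xpar x xX) => [|[w [_ _]]].
        by rewrite inE => /eqP ->; apply: dpos (mem_add o u v).
      by rewrite os => /(sub_add u v); apply: dpos.
    have so : size (out s x) <= d x.
      rewrite os; apply: leq_trans (dsize x); rewrite /o' /set_at; case: eqP => // -> /=.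
      exact: leqnSn.
    have := cmp_cost_r r (lab s u) (lab s x); rewrite /pop_cost /label_cost => hc.
    by case: ifP => _; nia.
  by move: hc1 hf sumX cmp; rewrite /label_cost; lia.
have {}hX := hX erefl.
have vu : ~~ connect (arrow o) v u.
  apply: (@search_complete B X) => //; first by apply: vX; rewrite inE.
  by move=> w wX; have := hX w wX; rewrite !inE orbN os; apply.
have [N3 [c3 [s' [E3 con' lu lo cost]]]] := update_insert vu ltuv.
exists (maxn (maxn N1 N2) N3), (Some s'),
  (1 + cmp_cost r (lab s u) (lab s v) + (c1 + (c2 + (c3 + 0)))).
split.
  move=> fuel; rewrite geq_max => /andP[NF1 NF3].
  move: NF1; rewrite geq_max => /andP[Nf1 Nf2].
  by apply: insertE; rewrite ?E2 //= E3.
split=> //.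
have Xpar' x : x \in X -> x = v \/
    exists w, [/\ w \in X, (rho r (lab s u) < rho r (lab s w))%O & x \in o w].
  by move=> /Xpar[|]; [rewrite inE => /eqP; left|rewrite os; right].
have Xr x : x \in X -> connect (arrow o') v x.
  move=> /XC; rewrite inE; apply: connect_sub => a b ab.
  by apply: connect1; apply: sub_add.
have fs := fsearch_cost rI con oU uv dsize dpos con' HB lu lo ltuv Xpar' Xr.
have ms : \sum_x 2 * d x * hweight r H x + mass r o' H' <=
    \sum_x 2 * d x * hweight r H' x + mass r o' H.
  rewrite -!big_split /=; apply: leq_sum => x _; have [B' EB] := HB x.
  have : hweight r H x <= hweight r H' x by rewrite /hweight EB weight_cat leq_addr.
  rewrite /hweight; have := dsize x; nia.
have split6 K : \sum_x 6 * d x * hweight r K x =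
    \sum_x 4 * d x * hweight r K x + \sum_x 2 * d x * hweight r K x.
  by rewrite -big_split; apply: eq_bigr => x _ /=; lia.
rewrite !split6 /label_cost; move: cost ms fs hc1 sumX cmp; rewrite -/H' /label_cost.
lia.
Qed.

End InsertSpec.

(** * Whole runs *)

Section Process.
Variable n : nat.
Implicit Types (s : state n) (H : 'I_n -> seq (seq 'I_n)) (x y z a b w u v : 'I_n).
Implicit Types (o : 'I_n -> seq 'I_n) (arcs : seq ('I_n * 'I_n)).

(* Unlike the algorithm, [hist] stops exactly at the first arc that closes a cycle, so
   it does not depend on the ranks. *)
Fixpoint hist o H arcs :=
  if arcs is (u, v) :: arcs' then
    if connect (arrow o) v u then H else
    let o' := set_at o u (v :: o u) in hist o' (hist_update n o' u v H) arcs'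
  else H.

(** The graph and the tail before each insertion, a list determined by the input alone. *)
Fixpoint searches o arcs :=
  if arcs is (u, v) :: arcs' then (o, u) :: searches (set_at o u (v :: o u)) arcs' else [::].

Lemma size_searches o arcs : size (searches o arcs) = size arcs.
Proof. by elim: arcs o => //= -[u v] arcs IH o /=; rewrite IH. Qed.

Lemma hist_cat o H arcs x : exists B, hist o H arcs x = H x ++ B.
Proof.
elim: arcs o H => /= [|[u v] arcs IH] o H; first by exists [::]; rewrite cats0.
case: ifP => _; first by exists [::]; rewrite cats0.
set o' := set_at _ _ _; have [B ->] := IH o' (hist_update n o' u v H).
by have [B' ->] := hist_update_cat o' n u v H x; exists (B' ++ B); rewrite catA.
Qed.

(** The number of reachable vertices strictly decreases along the arcs of a DAG. *)
Lemma valid_descending o H : acyclic o -> valid o H ->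
  exists key, forall x p, p \in H x -> descending key p.
Proof.
move=> oA vH; exists (fun x => #|Sset (arrow o) x|) => x p /vH[q _].
apply: sub_sorted => y z yz; apply: proper_card; apply/properP; split.
  by apply/fintype.subsetP => w; rewrite !inE; apply: connect_trans (connect1 yz).
by exists y; rewrite inE ?connect0 //; apply: oA.
Qed.

Lemma hist_descending o H arcs : acyclic o -> valid o H ->
  exists key, forall x p, p \in hist o H arcs x -> descending key p.
Proof.
elim: arcs o H => /= [|[u v] arcs IH] o H oA vH; first exact: valid_descending oA vH.
case: ifP => vu; first exact: valid_descending oA vH.
apply: IH; first by apply: acyclic_add => //; rewrite vu.
by apply: valid_hist_update; [apply: mem_add | apply: valid_add].
Qed.

Section Spec.
Variables (r : labeling n) (d : 'I_n -> nat) (t : nat).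
Hypothesis rI : rank_inj r.

(** [insert_spec] telescopes. The label size at each tail is bounded by the weight of the final
    history there, since that history does not depend on the ranks and can be averaged. *)
Lemma process_spec arcs o s H : consistent r o s H -> acyclic o -> (forall x, uniq (o x)) ->
  uniq arcs -> (forall a b, (a, b) \in arcs -> b \notin o a) ->
  (forall x, size (o x) + count (fun e => e.1 == x) arcs <= d x) ->
  (forall a b, b \in o a -> 0 < d b) -> (forall e, e \in arcs -> 0 < d e.2) ->
  exists N (b : bool) c, (forall fuel, N <= fuel -> process r fuel arcs s = Some (b, c)) /\
    c + \sum_x 6 * d x * hweight r H x <=
      \sum_x 6 * d x * hweight r (hist o H arcs) x + \sum_x 2 * d x * label_cost (lab s x)
      + (\sum_(e <- arcs) 4 * hweight r (hist o H arcs) e.1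
         + \sum_(p <- searches o arcs) 3 * search_bound p.1 p.2 (ranked r) t).
Proof.
elim: arcs o s H => [|[u v] arcs IH] o s H con oA oU Ua new dsize dpos dpos'.
  exists 0, false, 0; split=> //=.
  by rewrite !big_nil add0n !addn0 leq_addr.
case/andP: Ua => uvn Ua.
have uv : v \notin o u by apply: new; rewrite mem_head.
set o' := set_at o u (v :: o u).
have cnt x : size (o' x) + count (fun e => e.1 == x) arcs <= d x.
  apply: leq_trans (dsize x); rewrite /o' /set_at /=.
  by rewrite eq_sym; case: eqP => [->|_] /=; rewrite ?addSnnS.
have dpos1 a b : b \in o' a -> 0 < d b.
  move=> /arrow_add[|[_ ->]]; first exact: dpos.
  by apply: (dpos' (u, v)); rewrite mem_head.
have dsize1 x : size (o' x) <= d x by apply: leq_trans (cnt x); apply: leq_addr.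
have [_ _ sH _ _] := con.1.
have cb := label_class_bound rI con u t.
have wle B : label_cost (lab s u) <= weight r 3 [::] (H u ++ B).
  rewrite weight_cat; apply: leq_trans (leq_addr _ _).
  exact: (hweight_min rI).
have [N1 [[s'|] [c1 [E1]]]] := insert_spec rI con oA oU uv dsize1 dpos1; last first.
  move=> h1; exists N1, true, c1; split.
    by move=> fuel Nf /=; rewrite E1 //= addn0.
  rewrite [searches _ _]/= !big_cons.
  (* Whatever [hist] does from this arc on, it only appends paths. *)
  have [B EB] := hist_cat o H ((u, v) :: arcs) u.
  have h2 : label_cost (lab s u) <= hweight r (hist o H ((u, v) :: arcs)) u by rewrite /hweight EB.
  have h3 : \sum_x 6 * d x * hweight r H x <=
      \sum_x 6 * d x * hweight r (hist o H ((u, v) :: arcs)) x.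
    apply: leq_sum => x _; have [B' EB'] := hist_cat o H ((u, v) :: arcs) x.
    by rewrite leq_mul2l /hweight EB' weight_cat leq_addr orbT.
  move: h1 h2 h3 cb; rewrite /=; lia.
move=> [vu con' h1].
have new' a b : (a, b) \in arcs -> b \notin o' a.
  move=> ab; have nab := new a b; rewrite inE ab orbT in nab.
  apply/negP => /arrow_add[bo|[au bv]]; first by have := nab isT; rewrite bo.
  by move: uvn; rewrite -au -bv ab.
have dpos1' e : e \in arcs -> 0 < d e.2 by move=> ea; apply: dpos'; rewrite inE ea orbT.
have [N2 [b [c2 [E2 h2]]]] :=
  IH o' s' _ con' (acyclic_add oA vu) (uniq_add oU uv) Ua new' cnt dpos1 dpos1'.
exists (maxn N1 N2), b, (c1 + c2); split.
  by move=> fuel; rewrite geq_max => /andP[Nf1 Nf2] /=; rewrite E1 //= E2.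
have EH : hist o H ((u, v) :: arcs) = hist o' (hist_update n o' u v H) arcs.
  by rewrite /= (negbTE vu).
have h3 : label_cost (lab s u) <= hweight r (hist o H ((u, v) :: arcs)) u.
  by have [B EB] := hist_cat o H ((u, v) :: arcs) u; rewrite /hweight EB.
have ES : searches o ((u, v) :: arcs) = (o, u) :: searches o' arcs by [].
by rewrite ES !big_cons; move: h3 h1 h2 cb; rewrite EH -/o' /=; lia.
Qed.

End Spec.

Lemma label_init (r : labeling n) x : label r (fun _ _ => false) x = own r x.
Proof.
have E0 a b : connect (fun _ _ => false) a b = (a == b) :> bool.
  apply/idP/eqP => [|->]; last exact: connect0.
  by case/connectP => -[|z p] //= _ ->.
have n0 : 0 < n by apply: leq_ltn_trans (ltn_ord x).
rewrite /label -[X in label_from _ _ _ X](prednK n0); move: n.-1 => k /=.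
have PE : Pset (fun _ _ => false) x = [set x].
  by apply/setP => a; rewrite !inE E0.
rewrite PE /own; case: pickP => [y|none].
  rewrite finset.in_setI finset.in_set1 => /andP[/andP[/eqP -> xr] _]; rewrite xr; congr (_ :: _).
  case: k => //= k; case: pickP => // z.
  rewrite finset.in_setI in_setD1 finset.in_setI => /andP[/andP[/and3P[zx _]]].
  by rewrite inE E0 (negbTE zx).
case: ifP => // xr; have := none x; rewrite finset.in_setI finset.in_set1 eqxx xr /=.
by move/negbT/forall_inP; case=> y; rewrite finset.in_setI finset.in_set1 => /andP[/eqP->].
Qed.

Definition out0 : 'I_n -> seq 'I_n := fun=> [::].
Definition hist0 : 'I_n -> seq (seq 'I_n) := fun x => [:: [:: x]].

Lemma valid0 : valid out0 hist0.
Proof. by move=> x p; rewrite inE => /eqP->; exists [::]. Qed.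

Lemma consistent0 (r : labeling n) : consistent r out0 (init r) hist0.
Proof.
split=> //; split=> //; first exact: valid0.
have E x : lab (init r) x = path_label r [:: x] by rewrite /= label_init.
move=> x; split; first by exists [:: x]; rewrite ?E ?mem_head.
by move=> p; rewrite inE => /eqP->; rewrite E.
Qed.

Lemma acyclic0 : acyclic out0.
Proof. by []. Qed.

(** The potential [6 * d x] gives 6 to either end of an arc, as [d] counts incident arcs; the tail
    bears another 4 for its label at the insertion. *)
Definition run_bound (r : labeling n) arcs t :=
  \sum_(e <- arcs) (10 * hweight r (hist out0 hist0 arcs) e.1
                   + 6 * hweight r (hist out0 hist0 arcs) e.2)
  + \sum_(p <- searches out0 arcs) 3 * search_bound p.1 p.2 (ranked r) t.

Lemma sum_count (f : 'I_n * 'I_n -> 'I_n) (F : 'I_n -> nat) arcs :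
  \sum_x count (fun e => f e == x) arcs * F x = \sum_(e <- arcs) F (f e).
Proof.
elim: arcs => [|e arcs IH]; first by rewrite big_nil big1.
rewrite big_cons -IH /=; under eq_bigr do rewrite mulnDl.
rewrite big_split /=; congr (_ + _); rewrite (bigD1 (f e)) //= eqxx mul1n big1 ?addn0 //.
by move=> x xe; rewrite eq_sym (negbTE xe).
Qed.

Lemma run_spec (r : labeling n) arcs t : rank_inj r -> uniq arcs ->
  exists2 c, runs_in r arcs c & c <= run_bound r arcs t.
Proof.
move=> rI Ua.
pose d x := count (fun e => e.1 == x) arcs + count (fun e => e.2 == x) arcs.
have dsize x : size (out0 x) + count (fun e => e.1 == x) arcs <= d x by apply: leq_addr.
have dpos e : e \in arcs -> 0 < d e.2.
  move=> ea; rewrite addn_gt0 -has_count orbC -has_count; apply/orP; left.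
  by apply/hasP; exists e.
have dpos0 a b : b \in out0 a -> 0 < d b by [].
have [N [b [c [E h]]]] := process_spec t rI (consistent0 r) acyclic0
  (fun=> isT) Ua (fun _ _ _ => isT) dsize dpos0 dpos.
exists c; first by exists N, b; apply: E.
(* The labels of the initial state are paid for by the initial weights, one record for each
   vertex. *)
have h0 : \sum_x 2 * d x * label_cost (lab (init r) x) <= \sum_x 6 * d x * hweight r hist0 x.
  apply: leq_sum => x _; have [[_ _ sH _ _] _] := consistent0 r.
  by apply: leq_mul; [rewrite leq_mul2r orbT | apply: (hweight_min rI)].
have hd (F : 'I_n -> nat) : \sum_x 6 * d x * F x = \sum_(e <- arcs) (6 * F e.1 + 6 * F e.2).
  rewrite (eq_bigr (fun x => 6 * (count (fun e => e.1 == x) arcs * F x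
    + count (fun e => e.2 == x) arcs * F x))) => [|x _]; last by rewrite -mulnDl mulnA.
  rewrite -big_distrr big_split /= !sum_count -big_split big_distrr /=.
  by apply: eq_bigr => e _; rewrite mulnDr.
apply: (@leq_trans (\sum_x 6 * d x * hweight r (hist out0 hist0 arcs) x
  + (\sum_(e <- arcs) 4 * hweight r (hist out0 hist0 arcs) e.1
   + \sum_(p <- searches out0 arcs) 3 * search_bound p.1 p.2 (ranked r) t))).
  by move: h h0; lia.
rewrite hd addnA -big_split leq_add2r; apply: leq_sum => e _ /=; lia.
Qed.
End Process.

Local Open Scope ring_scope.

(** * Expected running time *)

Section Expectation.
Variables (R : realType) (n : nat) (q : R).
Hypotheses (q0 : 0 <= q) (q1 : q <= 1).
Implicit Types (L B : {set 'I_n}).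

Definition set_prob L : R := \prod_(v : 'I_n) (if v \in L then q else 1 - q).

Lemma set_prob_ge0 L : 0 <= set_prob L.
Proof. by apply: prodr_ge0 => v _; case: ifP => _; rewrite ?subr_ge0. Qed.

Lemma qexpect_le (X : labeling n -> R) (b : {set 'I_n} -> R) : (forall L, 0 <= b L) ->
  (forall L, \sum_(r in rankings L) X r <= b L * #|rankings L|%:R) ->
  qexpect q X <= \sum_L set_prob L * b L.
Proof.
move=> b0 h; apply: ler_sum => L _; apply: ler_wpM2l; first exact: set_prob_ge0.
(* Division by zero gives 0, so an empty class of rankings contributes nothing. *)
have [E|ne] := eqVneq #|rankings L| 0%N; first by rewrite E invr0 mulr0.
by rewrite ler_pdivrMr ?ltr0n ?lt0n.
Qed.

Lemma sum_set_prob : \sum_L set_prob L = 1.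
Proof.
transitivity (\prod_(v : 'I_n) (q + (1 - q))); first by rewrite bigA_distr.
by rewrite big1 // => v _; rewrite addrC subrK.
Qed.

Lemma sum_set_prob_card : \sum_L set_prob L * #|L|%:R = n%:R * q.
Proof.
have in1 v : \sum_L set_prob L * (v \in L)%:R = q.
  (* Giving weight 0 to the choice that leaves [v] out selects the sets containing [v] when the
     product is expanded. *)
  transitivity (\prod_w (q + (if w == v then 0 else 1 - q))); last first.
    rewrite (bigD1 v) //= eqxx addr0 big1 ?mulr1 // => w /negbTE ->.
    by rewrite addrC subrK.
  rewrite bigA_distr; apply: eq_bigr => L _.
  rewrite /set_prob (bigD1 v) //= [RHS](bigD1 v) //= eqxx.
  case: (v \in L); rewrite ?mulr1 ?mulr0 ?mul0r //; congr (_ * _).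
  by apply: eq_bigr => w /negbTE ->.
have -> : \sum_L set_prob L * #|L|%:R = \sum_L \sum_v set_prob L * (v \in L)%:R.
  by apply: eq_bigr => L _; rewrite -mulr_sumr -natr_sum -sum1_card [in LHS]big_mkcond.
by rewrite exchange_big /= (eq_bigr (fun=> q)) // sumr_const card_ord mulr_natl.
Qed.

Lemma sum_set_prob_disjoint B : \sum_L set_prob L * [disjoint B & L]%:R = (1 - q) ^+ #|B|.
Proof.
transitivity (\prod_w ((if w \in B then 0 else q) + (1 - q))); last first.
  rewrite -prodr_const [RHS]big_mkcond; apply: eq_bigr => w _.
  by case: (w \in B); rewrite ?add0r // addrC subrK.
rewrite bigA_distr; apply: eq_bigr => L _.
have [dis|/pred0Pn[x /andP[/= xB xL]]] := boolP [disjoint B & L].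
  rewrite mulr1; apply: eq_bigr => w _; case: (boolP (w \in L)) => // wL.
  by rewrite (disjointFl dis).
by rewrite mulr0 (bigD1 x) //= xL xB mul0r.
Qed.

Lemma sum_set_prob_gap B t : (t <= #|B|)%N ->
  \sum_L set_prob L * [disjoint B & L]%:R <= (1 - q) ^+ t.
Proof.
move=> tB; rewrite sum_set_prob_disjoint ler_wiXn2l // ?subr_ge0 //.
by rewrite lerBlDr lerDl.
Qed.

Lemma expect_search o u t :
  \sum_L set_prob L * (search_bound o u L t)%:R <=
    t%:R ^+ 2 + n%:R ^+ 2 * n.+1%:R * (1 - q) ^+ t.
Proof.
have y0 : 0 <= (1 - q) ^+ t by rewrite exprn_ge0 // subr_ge0.
have gap (c : bool) B : (c -> (t <= #|B|)%N) ->
    \sum_L set_prob L * (c && [disjoint B & L])%:R <= (1 - q) ^+ t.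
  case: c => /= [/(_ isT)|_]; first exact: sum_set_prob_gap.
  by rewrite big1 // => L _; rewrite mulr0.
have -> : \sum_L set_prob L * (search_bound o u L t)%:R =
    t%:R ^+ 2 * \sum_L set_prob L
    + n%:R ^+ 2 * (\sum_x \sum_L set_prob L * ((t < #|Dset (arrow o) x u|)%N &&
         [disjoint Dset (arrow o) x u :\ x & L])%:R)
    + n%:R ^+ 2 * (\sum_L set_prob L * ((t < #|Pset (arrow o) u|)%N &&
         [disjoint Pset (arrow o) u & L])%:R).
  rewrite exchange_big /= !mulr_sumr -!big_split /=; apply: eq_bigr => L _.
  rewrite /search_bound !natrD natrX !natrM natr_sum -!mulr_sumr; ring.
rewrite sum_set_prob mulr1 -addrA lerD2l -mulrDr -mulrA; apply: ler_wpM2l.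
  by rewrite exprn_ge0 // ler0n.
rewrite -natr1 mulrDl mul1r; apply: lerD.
  rewrite -[n in n%:R]card_ord mulr_natl -sumr_const; apply: ler_sum => x _.
  (* Removing [x] from the set costs one element, which the strict [t <] provides. *)
  apply: gap => h; rewrite -ltnS (leq_trans h) //.
  by rewrite (cardsD1 x) -add1n leq_add2r; case: (x \in _).
by apply: gap; apply: ltnW.
Qed.

End Expectation.

(** * Numerical estimates *)

Section Bounds.
Variables (R : realType).

(** Each new term is at most the growth of the logarithm, by [ln (1 + x) <= x] at
    [x = - 1 / n.+2]. *)
Lemma harmonic_le_ln n : (0 < n)%N -> harmonic R n <= 1 + ln n%:R.
Proof.
elim: n => [//|[|n] IH] _; first by rewrite /harmonic big_ord1 invr1 ln1 addr0.
rewrite harmonicS; apply: le_trans (lerD (IH isT) (lexx _)) _.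
rewrite -addrA lerD2l -lerBrDl -opprB lerNr.
have n1 : (0 < n.+1%:R :> R) by rewrite ltr0n.
have n2 : (0 < n.+2%:R :> R) by rewrite ltr0n.
rewrite -ln_div ?posrE //.
have -> : n.+1%:R / n.+2%:R = 1 + - n.+2%:R^-1 :> R.
  by rewrite -[X in X / _](addrK 1) natr1 mulrDl divff ?gt_eqF // mulN1r.
by rewrite le_ln1Dx // ltrN2 invf_lt1 // ltr1n.
Qed.
End Bounds.

Section Final.
Variables (R : realType).

Lemma sum_hweight n (arcs : seq ('I_n * 'I_n)) (L : {set 'I_n}) x :
  \sum_(r in rankings L) (hweight r (hist (@out0 n) (@hist0 n) arcs) x)%:R
    <= weight_bound R 3 #|L| * #|rankings L|%:R.
Proof.
have [key hk] := hist_descending arcs (@acyclic0 n) (@valid0 n).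
apply: (@sum_weight R n key L L (rankings L)) => //; first exact: swap_closed_rankings.
by move=> p pQ; split=> //; apply: hk pQ.
Qed.

(** The harmonic factor is first bounded by [harmonic R n]; the rest is linear in [#|L|], so that
    only its mean [n q] enters. The 16 is [10 + 6] from [run_bound]. *)
Lemma expect_run n (q : R) (arcs : seq ('I_n * 'I_n)) (t : nat) (X : labeling n -> nat) :
  0 <= q -> q <= 1 ->
  (forall r, r \in labelings n -> (X r <= run_bound r arcs t)%N) ->
  qexpect q (fun r => (X r)%:R) <=
    (size arcs)%:R * (16 * ((n%:R * q + 1) * (3 + harmonic R n))
      + 3 * (t%:R ^+ 2 + n%:R ^+ 2 * n.+1%:R * (1 - q) ^+ t)).
Proof.
move=> q0 q1 hX; set m : R := (size arcs)%:R.
pose sb (L : {set 'I_n}) : R :=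
  \sum_(p <- searches (@out0 n) arcs) 3 * (search_bound p.1 p.2 L t)%:R.
pose b (L : {set 'I_n}) : R := m * (16 * ((#|L|%:R + 1) * (3 + harmonic R n))) + sb L.
have m0 : 0 <= m by rewrite ler0n.
have hn0 : 0 <= 3 + harmonic R n by rewrite addr_ge0 ?harmonic_ge0.
have sb0 L : 0 <= sb L by apply: sumr_ge0 => p _; rewrite mulr_ge0.
apply: (le_trans (qexpect_le q0 q1 (b := b) _ _)).
- move=> L; rewrite addr_ge0 // mulr_ge0 // mulr_ge0 // mulr_ge0 //.
- move=> L.
  have wb : weight_bound R 3 #|L| <= (#|L|%:R + 1) * (3 + harmonic R n).
    rewrite /weight_bound natr1; apply: ler_wpM2l => //; rewrite lerD2l harmonic_le //.
    by rewrite -[n in (_ <= n)%N]card_ord max_card.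
  set K : R := #|rankings L|%:R; have K0 : 0 <= K by rewrite ler0n.
  pose w r x : R := (hweight r (hist (@out0 n) (@hist0 n) arcs) x)%:R.
  have step r : r \in rankings L ->
      (X r)%:R <= \sum_(e <- arcs) (10 * w r e.1 + 6 * w r e.2) + sb L.
    move=> rL; have [rE rI] := rankings_inj rL.
    have /hX : r \in labelings n by rewrite inE rE.
    rewrite -(ler_nat R) => /le_trans; apply.
    rewrite /run_bound natrD !natr_sum rE; apply: lerD; apply: ler_sum => e _.
      by rewrite natrD !natrM.
    by rewrite natrM.
  apply: le_trans (ler_sum _ step) _; rewrite big_split /= sumr_const.
  rewrite /b mulrDl -[sb L *+ _]mulr_natr lerD2r exchange_big /=.
  have e1 e : \sum_(r in rankings L) (10 * w r e.1 + 6 * w r e.2) <=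
      16 * ((#|L|%:R + 1) * (3 + harmonic R n)) * K.
    have h x : \sum_(r in rankings L) w r x <= (#|L|%:R + 1) * (3 + harmonic R n) * K.
      by apply: le_trans (sum_hweight arcs L x) _; apply: ler_wpM2r.
    rewrite big_split /= -!mulr_sumr; have := h e.1; have := h e.2; lra.
  apply: le_trans (ler_sum _ (fun e _ => e1 e)) _.
  by rewrite big_const_seq count_predT iter_addr_0 -[leRHS]mulrA [leRHS]mulr_natl.
rewrite /b; under eq_bigr do rewrite mulrDr.
rewrite big_split /= mulrDr; apply: lerD.
  have -> : \sum_(L : {set 'I_n}) set_prob q L * (m * (16 * ((#|L|%:R + 1) * (3 + harmonic R n)))) =
      m * (16 * (3 + harmonic R n)) *
        (\sum_(L : {set 'I_n}) set_prob q L * #|L|%:R + \sum_(L : {set 'I_n}) set_prob q L).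
    rewrite -big_split /= mulr_sumr; apply: eq_bigr => L _; ring.
  by rewrite sum_set_prob_card sum_set_prob le_eqVlt; apply/orP; left; apply/eqP; ring.
rewrite /sb; under eq_bigr do rewrite mulr_sumr.
rewrite exchange_big /=.
have e2 p : \sum_(L : {set 'I_n}) set_prob q L * (3 * (search_bound p.1 p.2 L t)%:R) <=
    3 * (t%:R ^+ 2 + n%:R ^+ 2 * n.+1%:R * (1 - q) ^+ t).
  have -> : \sum_(L : {set 'I_n}) set_prob q L * (3 * (search_bound p.1 p.2 L t)%:R) =
      3 * \sum_(L : {set 'I_n}) set_prob q L * (search_bound p.1 p.2 L t)%:R.
    by rewrite mulr_sumr; apply: eq_bigr => L _; ring.
  by apply: ler_wpM2l => //; apply: expect_search.
apply: le_trans (ler_sum _ (fun p _ => e2 p)) _.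
by rewrite big_const_seq count_predT iter_addr_0 size_searches [leRHS]mulr_natl.
Qed.

Lemma ln2_ge_half : (1 / 2 : R) <= ln 2.
Proof.
have h : ln (1 + - (1 / 2) : R) <= - (1 / 2) by apply: le_ln1Dx; lra.
have : ln (1 + - (1 / 2) : R) = - ln 2.
  by rewrite -lnV ?posrE //; congr ln; lra.
lra.
Qed.

(** [(1 - q) ^+ t] is at most [exp (- q t) <= n^-3]. The 3 in the threshold is what [n + 1] bad
    events of cost [n ^ 2] require. *)
Lemma gap_term_le2 n (q : R) t : (1 < n)%N -> 0 < q -> q <= 1 -> 3 * ln n%:R / q < t%:R ->
  n%:R ^+ 2 * n.+1%:R * (1 - q) ^+ t <= 2 :> R.
Proof.
move=> n1 q0 q1 ht.
have n0 : 0 < n%:R :> R by rewrite ltr0n; apply: ltnW.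
have h : (1 - q) ^+ t <= (n%:R ^+ 3)^-1.
  have le1 : 1 - q <= expR (- q) by apply: expR_ge1Dx.
  apply: le_trans (_ : expR (- q) ^+ t <= _).
    by apply: lerXn2r; rewrite ?nnegrE ?subr_ge0 ?expR_ge0.
  rewrite -expRM_natr -[n%:R]lnK ?posrE // -expRM_natr -expRN ler_expR.
  rewrite ltr_pdivrMr // in ht; lra.
have -> : 2 = n%:R ^+ 2 * (2 * n%:R) * (n%:R ^+ 3)^-1 :> R.
  by field; rewrite gt_eqF.
apply: ler_pM => //.
- by rewrite exprn_ge0 // subr_ge0.
- apply: ler_wpM2l; first by rewrite exprn_ge0 // ltW.
  by rewrite -natrM ler_nat mul2n -addnn -addn1 leq_add2l ltnW.
Qed.

(* To be used with [a] and [b] the cube roots of [n] and [ln n], so [q = b / a]. *)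
Lemma run_cost_arith (a b h t e : R) : 1 <= a -> 0 < b -> 1 / 2 <= b ^+ 3 ->
  0 <= h -> h <= 1 + b ^+ 3 -> 0 <= t -> t <= 3 * b ^+ 3 / (b / a) + 1 -> e <= 2 ->
  16 * ((a ^+ 3 * (b / a) + 1) * (3 + h)) + 3 * (t ^+ 2 + e) <= 1000 * a ^+ 2 * b ^+ 4.
Proof.
move=> a1 b0 b3 h0 hh t0 tt ee.
have a0 : 0 < a by lra.
have -> : a ^+ 3 * (b / a) = a ^+ 2 * b by field; rewrite gt_eqF.
have E : 3 * b ^+ 3 / (b / a) = 3 * (a * b ^+ 2) by field; rewrite !gt_eqF.
rewrite E in tt.
have b2 : 1 / 2 <= b.
  rewrite leNgt; apply/negP => lt.
  have : b ^+ 3 < (1 / 2) ^+ 3 by apply: ltrXn2r; rewrite ?nnegrE //; lra.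
  lra.
have mul_half (c x y : R) : 1 <= x -> c <= y -> 0 <= c -> c <= x * y.
  by move=> x1 cy c0; rewrite -[c]mul1r; apply: ler_pM.
have ab : 1 / 2 <= a ^+ 2 * b by apply: mul_half; rewrite ?exprn_ege1 //; lra.
have bb : 1 / 4 <= b ^+ 2.
  have -> : 1 / 4 = (1 / 2) ^+ 2 :> R by field.
  by apply: lerXn2r; rewrite ?nnegrE //; lra.
have ab2 : 1 / 4 <= a * b ^+ 2 by apply: mul_half => //; lra.
set x := a ^+ 2 * b in ab *; set y := a * b ^+ 2 in tt ab2.
have -> : 1000 * a ^+ 2 * b ^+ 4 = 1000 * (x * b ^+ 3) by rewrite /x; ring.
have y2 : y ^+ 2 = x * b ^+ 3 by rewrite /x /y; ring.
(* Here [t <= 3 * y + 1] and [1 <= 4 * y]; likewise below, [4 <= 8 * b ^+ 3] and [1 <= 2 * x]. *)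
have tb : t ^+ 2 <= 49 * y ^+ 2.
  have -> : 49 * y ^+ 2 = (7 * y) ^+ 2 by ring.
  by apply: lerXn2r; rewrite ?nnegrE //; lra.
have hb : 3 + h <= 9 * b ^+ 3 by lra.
have xb : x + 1 <= 3 * x by lra.
have : (x + 1) * (3 + h) <= (3 * x) * (9 * b ^+ 3) by apply: ler_pM => //; lra.
have : 1 / 4 <= x * b ^+ 3.
  have -> : 1 / 4 = 1 / 2 * (1 / 2) :> R by field.
  by apply: ler_pM => //; lra.
rewrite y2 in tb; move: tb; set z := x * b ^+ 3.
have -> : 3 * x * (9 * b ^+ 3) = 27 * z by rewrite /z; ring.
(* In multiples of [z]: [16 * 27 + 3 * 49 + 24 = 603], where 24 covers [3 * e <= 6]. *)
lra.
Qed.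

End Final.

Unset Implicit Arguments.

Theorem theorem3 (R : realType) :
  exists C : R, 0 < C /\
  forall (n : nat) (arcs : seq ('I_n * 'I_n)),
    (1 < n)%N -> uniq arcs ->
    exists T : labeling n -> nat,
      (forall r : labeling n, r \in labelings n -> runs_in r arcs (T r)) /\
      qexpect ((ln n%:R / n%:R) `^ (3%:R^-1)) (fun r => (T r)%:R)
        <= C * (size arcs)%:R * n%:R `^ (2%:R / 3%:R)
             * (ln n%:R) `^ (4%:R / 3%:R).
Proof.
exists 1000; split=> [|n arcs n1 Ua]; first by rewrite ltr0n.
have n0 : 0 < n%:R :> R by rewrite ltr0n ltnW.
have l0 : 0 < ln n%:R :> R by rewrite ln_gt0 // ltr1n.
pose a : R := n%:R `^ 3^-1; pose b : R := ln n%:R `^ 3^-1.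
have a0 : 0 < a by rewrite powR_gt0.
have b0 : 0 < b by rewrite powR_gt0.
have cube (x : R) : 0 < x -> (x `^ 3^-1) ^+ 3 = x.
  by move=> x0; rewrite -powR_mulrn ?powR_ge0 // -powRrM mulVf // powRr1 // ltW.
have a3 : a ^+ 3 = n%:R by apply: cube.
have b3 : b ^+ 3 = ln n%:R by apply: cube.
set q := (ln n%:R / n%:R) `^ (3%:R^-1).
have qE : q = b / a.
  have an0 : a != 0 by rewrite gt_eqF.
  rewrite -[q](mulfK an0); congr (_ / _).
  by rewrite /q /a /b -powRM ?divfK ?gt_eqF // ?ltW // divr_gt0.
have q0 : 0 < q by rewrite qE divr_gt0.
have ba : b <= a.
  rewrite /a /b; apply: ge0_ler_powR; rewrite ?nnegrE ?invr_ge0 ?(ltW l0) ?(ltW n0) //.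
  by apply: ltW; apply: ln_sublinear.
have q1 : q <= 1 by rewrite qE ler_pdivrMr // mul1r.
pose x : R := 3 * ln n%:R / q.
have x0 : 0 <= x by rewrite /x divr_ge0 ?mulr_ge0 // ltW.
(* An integer strictly above [x] and at most [x + 1]. *)
pose t := (Num.truncn x).+1.
have /andP[t1 t2] := truncn_itv x0.
have [T hT] : {T : labeling n -> nat & forall r, r \in labelings n ->
    runs_in r arcs (T r) /\ (T r <= run_bound r arcs t)%N}.
  apply: (@boolp.choice _ _ (fun r c => r \in labelings n ->
    runs_in r arcs c /\ (c <= run_bound r arcs t)%N)) => r.
  have [rl|] := boolP (r \in labelings n); last by exists 0%N.
  by have [c c1 c2] := run_spec t (labelings_rank_inj rl) Ua; exists c.
exists T; split=> [r /hT[]//|].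
apply: le_trans (expect_run (ltW q0) q1 (fun r rl => (hT r rl).2)) _.
have -> : n%:R `^ (2%:R / 3%:R) = a ^+ 2 :> R.
  by rewrite mulrC powRrM powR_mulrn // powR_ge0.
have -> : ln n%:R `^ (4%:R / 3%:R) = b ^+ 4 :> R.
  by rewrite mulrC powRrM powR_mulrn // powR_ge0.
have -> : 1000 * (size arcs)%:R * a ^+ 2 * b ^+ 4 =
    (size arcs)%:R * (1000 * a ^+ 2 * b ^+ 4) by ring.
apply: ler_wpM2l => //; rewrite -a3 qE; apply: run_cost_arith => //.
- by rewrite -(@ler_pXn2r _ 3) ?nnegrE ?(ltW a0) // expr1n a3 ler1n ltnW.
- rewrite b3; apply: le_trans (ln2_ge_half R) _; rewrite ler_ln ?posrE // ler_nat //.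
- exact: harmonic_ge0.
- by rewrite b3; apply: harmonic_le_ln; apply: ltnW.
- by rewrite b3 -qE /t -natr1 lerD2r.
- by rewrite a3 -qE; apply: gap_term_le2.
Qed.
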